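(* Let $n\ge 2$ be an integer and $p\in\{0,\dots,n\}$. (a) $(GLSym_n(p), g)$ is a totally geodesic submanifold of $(GL_n, g)$, and its geodesics are precisely the curves of the form $t \mapsto K e^{tC}$ with $K \in GLSym_n(p)$ and $C = K^{-1}V$ with $V \in Sym_n$. In particular $(GLSym_n(p), g)$ is geodesically complete. (b) Let $K \in GLSym_n(p)$ and $X, Y, Z, W \in Sym_n = T_K(GLSym_n(p))$. The Riemann curvature tensor of type $(0,4)$ of $(GLSym_n(p), g)$ at $K$ is $$R_{XYZW}(K) = \frac{1}{4}\, \mathrm{tr}\big([K^{-1}X, K^{-1}Y]\,[K^{-1}Z, K^{-1}W]\big).$$
   Context: $GL_n$ is the group of non-singular real $n\times n$ matrices and $M_n$ the space of all real $n\times n$ matrices. $Sym_n$ is the vector space of real symmetric $n\times n$ matrices. $GLSym_n(p)$ ($0\le p\le n$) is the set of non-singular matrices in $Sym_n$ with signature $(p,n-p)$ ($p$ positive and $n-p$ negative eigenvalues); it is an open subset of $Sym_n$, so its tangent space at every point is $Sym_n$. The trace metric $g$ on $GL_n$ is $g_A(V,W)=\mathrm{tr}(A^{-1}VA^{-1}W)$ for $A\in GL_n$, $V,W\in T_A GL_n=M_n$; the same symbol denotes its restriction to submanifolds. On $GL_n$ it is a semi-Riemannian metric, and its restriction to $GLSym_n(p)$ is also semi-Riemannian. $[A,B]=AB-BA$ and $e^A$ is the matrix exponential. Sign convention for the curvature tensor: the sectional curvature of a non-degenerate tangent plane spanned by $X,Y$ is $R_{XYXY}/\big(g(X,X)g(Y,Y)-g(X,Y)^2\big)$,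 i.e. $R_{XYZW}=g(R_{XY}Z,W)$ with $R_{XY}Z=\nabla_{[X,Y]}Z-\nabla_X\nabla_YZ+\nabla_Y\nabla_XZ$. *)

(* Defs.v *)
From HB Require Import structures.
From mathcomp Require Import all_boot all_order all_algebra.
From mathcomp Require Import all_classical all_reals all_analysis.

Set Implicit Arguments.
Unset Strict Implicit.
Unset Printing Implicit Defensive.

Import Order.TTheory GRing.Theory Num.Theory.
Import numFieldNormedType.Exports.

Local Open Scope classical_set_scope.
Local Open Scope ring_scope.

(* Every manifold below is given by a linear subspace S of the space of real  *)
(* n x n matrices and a relatively open subset U of S: the identity is a      *)
(* global chart and the tangent space at every point of U is S.  Matrix- and  *)
(* scalar-valued functions on U are total functions on matrices; only their   *)
(* values on U are ever relevant, since the derivative 'D_v f x with x in U   *)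
(* and v in S depends only on f restricted to U.                              *)

Section SubmanifoldCalculus.
Variables (R : realType) (n : nat).
Local Notation M := 'M[R]_n.
Implicit Types (U I : set M) (S : {vspace M}) (X Y Z W : M -> M).

Definition submanifold U S :=
  exists O : set M, open O /\ U = O `&` [set` S].

(* All partial derivatives of order <= k in the directions of S exist and are *)
(* continuous on U.                                                           *)
Fixpoint Ck U S (F : normedModType R) (k : nat) (f : M -> F) : Prop :=
  {within U, continuous f} /\
  match k with
  | 0%N => True
  | k'.+1 => forall v : M, v \in S ->
      (forall x, U x -> derivable f x v) /\ Ck U S k' (fun x => 'D_v f x)
  end.

Definition smooth U S (F : normedModType R) (f : M -> F) :=
  forall k : nat, Ck U S k f.

Definition vector_field U S X :=
  (forall x, U x -> X x \in S) /\ smooth U S X.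

Definition lie_bracket X Y : M -> M :=
  fun x => 'D_(X x) Y x - 'D_(Y x) X x.

(* (0,2)-tensors: g x v w is the value at the point x on the vectors v, w.    *)
Implicit Type g : M -> M -> M -> R.

Definition negative_definite_on g (x : M) (V : {vspace M}) :=
  forall v : M, v \in V -> v != 0 -> g x v v < 0.

Definition index_at S g (x : M) (k : nat) :=
  (exists V : {vspace M},
     [/\ (V <= S)%VS, negative_definite_on g x V & \dim V = k]) /\
  (forall V : {vspace M},
     (V <= S)%VS -> negative_definite_on g x V -> (\dim V <= k)%N).

Definition semi_riemannian_metric U S g :=
  [/\ (forall x, U x -> forall (a : R) (u v w : M),
         u \in S -> v \in S -> w \in S ->
         g x (a *: u + v) w = a * g x u w + g x v w),
      (forall x, U x -> forall v w : M,
         v \in S -> w \in S -> g x v w = g x w v),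
      (forall x, U x -> forall v : M, v \in S ->
         (forall w : M, w \in S -> g x v w = 0) -> v = 0),
      (forall v w : M, v \in S -> w \in S ->
         smooth U S ((fun x => g x v w) : M -> R^o)) &
      exists k : nat, forall x, U x -> index_at S g x k].

(* Covariant derivatives: nb X Y is the derivative of Y in the direction X.   *)
Definition covariant_derivative := (M -> M) -> (M -> M) -> (M -> M).
Implicit Type nb : covariant_derivative.

Definition affine_connection U S nb :=
  [/\ (forall X Y, vector_field U S X -> vector_field U S Y ->
         vector_field U S (nb X Y)),
      (forall (f : M -> R^o) X Y Z, smooth U S f ->
         vector_field U S X -> vector_field U S Y -> vector_field U S Z ->
         forall x, U x ->
         nb (fun y => f y *: X y + Y y) Z x = f x *: nb X Z x + nb Y Z x),
      (forall (a : R) X Y Z,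
         vector_field U S X -> vector_field U S Y -> vector_field U S Z ->
         forall x, U x ->
         nb X (fun y => a *: Y y + Z y) x = a *: nb X Y x + nb X Z x) &
      (forall (f : M -> R^o) X Y, smooth U S f ->
         vector_field U S X -> vector_field U S Y ->
         forall x, U x ->
         nb X (fun y => f y *: Y y) x =
           ('D_(X x) f x : R) *: Y x + f x *: nb X Y x)].

Definition torsion_free U S nb :=
  forall X Y, vector_field U S X -> vector_field U S Y ->
  forall x, U x -> nb X Y x - nb Y X x = lie_bracket X Y x.

Definition metric_compatible U S g nb :=
  forall X Y Z, vector_field U S X -> vector_field U S Y ->
    vector_field U S Z ->
  forall x, U x ->
    'D_(X x) ((fun y => g y (Y y) (Z y)) : M -> R^o) x =
      g x (nb X Y x) (Z x) + g x (Y x) (nb X Z x).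

Definition is_levi_civita U S g nb :=
  [/\ affine_connection U S nb, torsion_free U S nb &
      metric_compatible U S g nb].

(* For a semi-Riemannian metric on a submanifold such a connection exists,    *)
(* and its values on vector fields are uniquely determined on U; the default  *)
(* value is then irrelevant.                                                  *)
Definition levi_civita U S g : covariant_derivative :=
  xget (fun _ _ _ => 0) [set nb | is_levi_civita U S g nb].

(* Christoffel symbols in the identity chart, whose coordinate fields are     *)
(* the constant ones.                                                         *)
Definition christoffel U S g (x u v : M) : M :=
  levi_civita U S g (fun _ => u) (fun _ => v) x.

Definition open_interval (J : set R) :=
  [/\ J !=set0, open J & is_interval J].

Definition smooth_curve (J : set R) (c : R -> M) :=
  forall (k : nat) t, J t -> derivable (derive1n k c) t 1.

(* Acceleration (covariant derivative of the velocity along the curve).       *)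
Definition acceleration U S g (c : R -> M) (t : R) : M :=
  derive1n 2 c t + christoffel U S g (c t) (derive1 c t) (derive1 c t).

Definition geodesic U S g (J : set R) (c : R -> M) :=
  [/\ smooth_curve J c, (forall t, J t -> U (c t)) &
      forall t, J t -> acceleration U S g c t = 0].

Definition geodesically_complete U S g :=
  forall (J : set R) (c : R -> M), open_interval J -> geodesic U S g J c ->
  exists c' : R -> M,
    geodesic U S g setT c' /\ forall t, J t -> c' t = c t.

(* (U, S) is a semi-Riemannian submanifold of (U', S') and its second         *)
(* fundamental form vanishes: the normal part of the ambient derivative of    *)
(* fields that are tangent along U is zero.                                   *)
Definition totally_geodesic U S U' S' g :=
  [/\ submanifold U' S' /\ submanifold U S,
      U `<=` U' /\ (S <= S')%VS,
      semi_riemannian_metric U' S' g /\ semi_riemannian_metric U S g &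
      forall X Y, vector_field U' S' X -> vector_field U' S' Y ->
        (forall x, U x -> X x \in S) -> (forall x, U x -> Y x \in S) ->
        forall x, U x -> levi_civita U' S' g X Y x \in S].

(* Sign convention: the sectional curvature of the plane spanned by X and Y   *)
(* is R_XYXY / (g(X,X) g(Y,Y) - g(X,Y)^2).                                    *)
Definition riemann U S g X Y Z : M -> M :=
  let nb := levi_civita U S g in
  fun x => nb (lie_bracket X Y) Z x - nb X (nb Y Z) x + nb Y (nb X Z) x.

Definition riemann4 U S g X Y Z W (x : M) : R :=
  g x (riemann U S g X Y Z x) (W x).

End SubmanifoldCalculus.

Section MatrixManifolds.
Variables (R : realType) (n : nat).
Local Notation M := 'M[R]_n.

Definition GL : set M := [set A | A \in unitmx].

Definition Sym : {vspace M} := lker (linfun (fun A : M => A^T - A)).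

Lemma SymP (A : M) : reflect (A^T = A) (A \in Sym).
Proof.
pose f := fun B : M => B^T - B.
have lf : linear f.
  by move=> a B C; rewrite /f linearP /= scalerBr opprD addrACA.
pose F := GRing.isLinear.Build R M M *:%R f lf.
pose g : {linear M -> M} := HB.pack f F.
rewrite memv_ker -[linfun _]/(linfun g) lfunE /= /f subr_eq0.
exact: eqP.
Qed.

(* p positive and q negative eigenvalues, counted with multiplicity.          *)
Definition has_signature (A : M) (p q : nat) :=
  exists s : seq R,
    [/\ char_poly A = \prod_(a <- s) ('X - a%:P),
        count (fun a => 0 < a) s = p & count (fun a => a < 0) s = q].

Definition GLSym (p : nat) : set M :=
  [set A | [/\ A \in Sym, A \in unitmx & has_signature A p (n - p)]].

Definition trace_metric (A V W : M) : R :=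
  \tr (invmx A *m V *m invmx A *m W).

Definition commutator (A B : M) : M := A *m B - B *m A.

Definition expmx (A : M) : M :=
  lim (series (fun k : nat => (k`!%:R)^-1 *: (A ^+ k)) @ \oo).

End MatrixManifolds.

Arguments GL : clear implicits.
Arguments Sym : clear implicits.
Arguments GLSym : clear implicits.

(* Main.v *)
From HB Require Import structures.
From mathcomp Require Import perm complex zify ring lra.
Require Import Defs.
From mathcomp Require Import all_boot all_order all_algebra.
From mathcomp Require Import all_classical all_reals all_analysis.

Set Implicit Arguments.
Unset Strict Implicit.
Unset Printing Implicit Defensive.

Import Order.TTheory GRing.Theory Num.Theory.
Import numFieldNormedType.Exports.
Local Open Scope classical_set_scope.
Local Open Scope ring_scope.

(** A point A of either manifold is an invertible matrix, and the identity chart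
    gives the trace metric the Christoffel form
    Gamma_A(u, v) = - (u A^-1 v + v A^-1 u) / 2.  Indeed the connection
    'D_X Y + Gamma(X, Y) is symmetric, and it is compatible with the metric by
    the derivative - A^-1 v A^-1 of the inverse and the cyclicity of the trace
    ([trace_connection_levi_civita]).  As the Levi-Civita connection is unique
    ([levi_civita_unique]), it is given by this formula on every semi-Riemannian
    submanifold (U, S) of GL such that Gamma maps S x S to S.  This holds for
    all matrices and, since transposition exchanges the two terms of Gamma, for symmetric
    ones at a symmetric A: the same formula serves both manifolds, whence
    the submanifold of symmetric matrices is totally geodesic.

    Curvature.  In R_XY Z, written with this formula, everything that contains a
    derivative of X, Y or Z cancels, the second derivatives of Z by the symmetry
    [Ck_derive_commute].  What is left is a combination of the products of
    A^-1 X, A^-1 Y and A^-1 Z in their various orders, namely one quarter of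
    the double commutator; pairing it with W gives the trace of two commutators
    ([curvature_trace], [riemann4E]).

    Geodesics.  The geodesic equation is c'' = c' c^-1 c', which says that
    C = c^-1 c' is constant.  So c' = c C and c = K e^(tC).  The converse needs
    K e^(tC) to keep the signature of K: as K C is symmetric, K e^(tC) is
    the congruent matrix P^T K P with P = e^(tC/2) ([expmx_congruence]).  These
    curves are defined for all times, which is completeness.

    Signature.  Real symmetric matrices are orthogonally diagonalisable
    ([symmetric_spectral]), so a symmetric invertible matrix is congruent to
    a diagonal matrix E of signs ([sylvester_normal_form]), and the number
    of positive signs can be read off from the definiteness of the form on complementary
    coordinate subspaces ([signature_criterion]).  Definiteness survives small
    perturbations, hence GLSym(p) is open in the symmetric matrices.

    Index.  At A the metric is tr (B B) in the variable B = A^-1 v on GL, and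
    tr (E B E B) in the variable B = Q^-T v Q^-1 on GLSym(p), where A = Q^T E Q.
    Both have the form <theta B, B> for the Frobenius product and
    an involution theta independent of A, so that the index is the dimension
    of the (-1)-eigenspace of theta ([index_involution]). *)

(** * Directional derivatives *)

Section DirectionalDerivatives.
Variables (R : realType) (V W : normedModType R).
Implicit Types (f g : V -> W) (x v w : V).

Lemma is_deriveP (F : normedModType R) (f : V -> F) x v df :
  is_derive x v f df <->
  h^-1 *: (f (h *: v + x) - f x) @[h --> (0 : R)^'] --> df.
Proof.
split=> [[dvf <-]|fdf]; first exact: dvf.
by split; [apply/cvg_ex; exists df | exact/cvg_lim].
Qed.

Lemma is_deriveE f x v df : is_derive x v f df -> 'D_v f x = df.
Proof. by move=> fdf; exact: derive_val. Qed.

Lemma cvg_line (x v : V) : h *: v + x @[h --> (0 : R)] --> x.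
Proof.
rewrite -[X in _ --> X](add0r x) -[X in X + x](scale0r v).
by apply: cvgD; [apply: cvgZr_tmp; exact: cvg_id | exact: cvg_cst].
Qed.

Lemma near0_line (x v : V) (P : set V) :
  nbhs x P -> \forall h \near (0 : R), P (h *: v + x).
Proof. exact: cvg_line. Qed.

(** The quotient for a v and step h is a times the quotient for v and step h a. *)
Lemma is_deriveZv f x v df (a : R) :
  is_derive x v f df -> is_derive x (a *: v) f (a *: df).
Proof.
have [-> _|a0 /is_deriveP fdf] := eqVneq a 0.
  by rewrite !scale0r; exact: is_derive0.
apply/is_deriveP.
have aa : h * a @[h --> (0 : R)^'] --> (0 : R)^'.
  move=> P; rewrite !near_simpl => /nbhs_ballP[e e0 He].
  apply/nbhs_ballP; exists (e / `|a|); first by rewrite /= divr_gt0 ?normr_gt0.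
  move=> h; rewrite /ball /= sub0r normrN ltr_pdivlMr ?normr_gt0// => he hn0.
  apply: He; last by rewrite mulf_neq0.
  by rewrite /ball /= sub0r normrN normrM.
have H := cvg_comp _ _ aa fdf.
apply: (cvg_trans _ (@cvgZl_tmp _ _ _ _ _ a _ _ H)).
apply: near_eq_cvg; apply: nearW => h /=.
by rewrite scalerA invfM mulrCA mulfV// mulr1 scalerA.
Qed.

(** Turns a derivative in a direction into that of a function of one real
    variable, to which the mean value theorem applies. *)
Lemma is_derive_line f x w (t : R) df :
  is_derive (t *: w + x) w f df ->
  is_derive t (1 : R) (fun s : R => f (s *: w + x)) df.
Proof.
have E : (fun h => h^-1 *: (((fun s : R => f (s *: w + x)) \o shift t) (h *: 1)
      - f (t *: w + x))) =
    (fun h => h^-1 *: ((f \o shift (t *: w + x)) (h *: w) - f (t *: w + x))).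
  by apply/funext => h /=; rewrite [h *: 1]mulr1 scalerDl addrA.
by move=> [fdf fE]; apply: DeriveDef; rewrite /derivable /derive E.
Qed.

Lemma derivable_cvg_line f x v : derivable f x v ->
  f (h *: v + x) @[h --> (0 : R)] --> f x.
Proof.
move=> /derivable1P/derivable1_diffP/differentiable_continuous fc.
rewrite -[in X in _ --> X](add0r x) -(scale0r v); exact: fc.
Qed.

Lemma is_derive_scale (f : V -> R^o) g x v (df : R) dg :
  is_derive x v f df -> is_derive x v g dg ->
  is_derive x v (fun y => f y *: g y) (df *: g x + f x *: dg).
Proof.
move=> fdf gdg; apply/is_deriveP.
have gc : g (h *: v + x) @[h --> (0 : R)^'] --> g x.
  have [dg_ex _] := gdg.
  by apply: cvg_within_filter; exact: derivable_cvg_line dg_ex.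
have {}fdf := (is_deriveP _ _ _ _).1 fdf.
have {}gdg := (is_deriveP _ _ _ _).1 gdg.
have H : (fun h : R => (h^-1 *: (f (h *: v + x) - f x) : R) *: g (h *: v + x) +
    f x *: (h^-1 *: (g (h *: v + x) - g x))) @ (0 : R)^' --> df *: g x + f x *: dg.
  by apply: cvgD; [exact: cvgZ | apply: cvgZl_tmp; exact: gdg].
apply: (cvg_trans _ H); apply: near_eq_cvg; apply: nearW => h /=.
rewrite scalerA mulrC -!scalerA -scalerDr; congr (_ *: _).
by rewrite scalerBl scalerBr addrA subrK.
Qed.

Lemma is_derive_linear (W' : normedModType R) (L : {linear W -> W'}) f x v df :
  continuous L -> is_derive x v f df ->
  is_derive x v (fun y => L (f y)) (L df).
Proof.
move=> Lc /is_deriveP fdf; apply/is_deriveP.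
have := cvg_comp _ _ fdf (Lc df).
apply: cvg_trans; apply: near_eq_cvg; apply: nearW => h /=.
by rewrite linearZ linearB.
Qed.

End DirectionalDerivatives.

(** A matrix is the sum of its entries times elementary matrices, so a linear map
    is a finite sum of coordinates times constants. *)
Lemma linear_mx_continuous (R : realType) m n (F : normedModType R)
  (L : {linear 'M[R]_(m, n) -> F}) : continuous L.
Proof.
have -> : (L : _ -> _) =
    (fun A => \sum_i \sum_j A i j *: L (delta_mx i j)).
  apply/funext => A; rewrite {1}[A]matrix_sum_delta linear_sum.
  apply: eq_bigr => i _; rewrite linear_sum; apply: eq_bigr => j _.
  by rewrite linearZ.
apply: continuous_big => [|i _]; first exact: add_continuous.
apply: continuous_big => [|j _]; first exact: add_continuous.
by move=> A; exact: (cvgZr_tmp (@coord_continuous R m n i j A)).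
Qed.

(** Mean value theorem on s |-> f (s w + x).  The step length is part of w, so no
    sign of the step has to be distinguished. *)
Lemma mvt_direction (R : realType) (V : normedModType R) (f : V -> R^o)
    (x w : V) :
  (forall t, `|t| <= 1 -> derivable f (t *: w + x) w) ->
  exists2 t, `|t| <= 1 & f (w + x) - f x = 'D_w f (t *: w + x).
Proof.
move=> df.
pose g (s : R) : R := f (s *: w + x).
pose dg (s : R) : R := 'D_w f (s *: w + x).
have d (t : R) : t \in `[0, 1] -> is_derive t (1 : R) (g : R -> R^o) (dg t).
  rewrite in_itv /= => /andP[t0 t1].
  apply: (@is_derive_line R V R^o f x w t); apply: derivableP.
  by apply/df; rewrite ger0_norm.
have d' (t : R) : t \in `]0, 1[ -> is_derive t (1 : R) (g : R -> R^o) (dg t).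
  by move=> /subset_itv_oo_cc; exact: d.
have c : {within `[0, 1], continuous g}.
  apply: (@derivable_within_continuous R R^o g) => t ht.
  by case: (d t ht).
have [t] := @MVT R g dg 0 1 ltr01 d' c.
rewrite in_itv /= => /andP[t0 t1].
rewrite subr0 mulr1 /g scale0r add0r scale1r => E.
by exists t => //; rewrite ger0_norm ltW.
Qed.

(** * Relatively open subsets of a linear subspace *)

Section RelativelyOpen.
Variables (R : realType) (n : nat) (U : set 'M[R]_n) (S : {vspace 'M[R]_n}).
Hypothesis US : submanifold U S.
Local Notation M := 'M[R]_n.

Lemma submanifold_near (x v : M) : U x -> v \in S ->
  \forall h \near (0 : R), U (h *: v + x).
Proof.
case: US => O [oO UE]; rewrite UE => -[Ox Sx] Sv.
near=> h; split; last by rewrite /= rpredD// rpredZ.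
by near: h; apply: near0_line; exact: open_nbhs_nbhs.
Unshelve. all: by end_near. Qed.

(** Every neighbourhood of x relative to U contains a small parallelogram
    spanned by u and v: the domain on which two-parameter increments are
    estimated. *)
Lemma within_square (x u v : M) (P : set M) : U x -> u \in S -> v \in S ->
  (\forall y \near within U (nbhs x), P y) ->
  exists2 d : R, 0 < d & forall s t, `|s| <= d -> `|t| <= d ->
    U (s *: u + (t *: v + x)) /\ P (s *: u + (t *: v + x)).
Proof.
case: US => O [oO UE] Ux Su Sv Px.
have Ox : O x by move: Ux; rewrite UE => -[].
have Sx : x \in S by move: Ux; rewrite UE => -[].
have : \forall y \near x, O y /\ (U y -> P y).
  by near=> y; split; near: y; [exact: open_nbhs_nbhs|exact: Px].
move=> /nbhs_ballP[e /= e0 He].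
have c0 : 0 < `|u| + `|v| + 1 by rewrite ltr_wpDl// addr_ge0.
(* the term 1 covers u = v = 0, and the factor 1/2 makes the bound strict *)
exists (e / (`|u| + `|v| + 1) / 2); first by rewrite !divr_gt0.
move=> s t hs ht; have [|Oy PU] := He (s *: u + (t *: v + x)).
  rewrite -ball_normE /= addrA [in X in _ - X]addrC opprD addrA subrr sub0r.
  rewrite normrN.
  set d := e / _ in hs ht *.
  have d0 : 0 < d by rewrite divr_gt0.
  apply: le_lt_trans (ler_normD _ _) _; rewrite !normrZ.
  have eE : e = d * (`|u| + `|v| + 1) by rewrite /d divfK// gt_eqF.
  rewrite eE.
  have hu := ler_wpM2r (normr_ge0 u) hs.
  have hv := ler_wpM2r (normr_ge0 v) ht.
  have p1 := mulr_ge0 (ltW d0) (normr_ge0 u).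
  have p2 := mulr_ge0 (ltW d0) (normr_ge0 v).
  rewrite !mulrDr mulr1 in eE *; nra.
have Uy : U (s *: u + (t *: v + x)).
  by rewrite UE; split => //=; rewrite rpredD ?rpredZ// rpredD ?rpredZ.
by split => //; exact: PU.
Unshelve. all: by end_near. Qed.

(** Relative openness keeps x + h v inside U for small h, so that derivatives
    along S see only the values on U. *)
Lemma is_derive_ext (F : normedModType R) (f g : M -> F) x v df :
  U x -> v \in S -> (forall y, U y -> f y = g y) ->
  is_derive x v f df -> is_derive x v g df.
Proof.
move=> Ux Sv fg /is_deriveP fdf; apply/is_deriveP; move: fdf.
apply: cvg_trans; apply: near_eq_cvg; near=> h; rewrite /= !fg//.
near: h; apply: cvg_within; exact: submanifold_near.
Unshelve. all: by end_near. Qed.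

Lemma derive_ext (F : normedModType R) (f g : M -> F) x v :
  U x -> v \in S -> (forall y, U y -> f y = g y) ->
  'D_v f x = 'D_v g x.
Proof.
move=> Ux Sv fg; rewrite /derive; congr (lim _).
rewrite eqEsubset; split; apply: near_eq_cvg; near=> h; rewrite /= !fg//;
  near: h; apply: cvg_within; exact: submanifold_near.
Unshelve. all: by end_near. Qed.

Lemma derivable_ext (F : normedModType R) (f g : M -> F) x v :
  U x -> v \in S -> (forall y, U y -> f y = g y) ->
  derivable f x v -> derivable g x v.
Proof.
move=> Ux Sv fg df.
by case: (is_derive_ext Ux Sv fg (derivableP df)).
Qed.

End RelativelyOpen.

(** * Dependence on the direction and symmetry of second derivatives *)

Lemma is_derive_translate (R : realType) (V W : normedModType R) (f : V -> W)
    (c x v : V) df :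
  is_derive (c + x) v f df -> is_derive x v (fun y => f (c + y)) df.
Proof.
move=> /is_deriveP fdf; apply/is_deriveP.
suff -> : (fun h : R => h^-1 *: (f (c + (h *: v + x)) - f (c + x))) =
  (fun h : R => h^-1 *: (f (h *: v + (c + x)) - f (c + x))) by [].
by apply/funext => h; rewrite addrCA.
Qed.

(** The increment along u + v is the one along u, followed by one along v that
    starts from the moving point h u + x. *)
Lemma is_deriveDv (R : realType) (V W : normedModType R) (f : V -> W)
    (x u v : V) a b :
  h^-1 *: (f (h *: u + x) - f x) @[h --> (0 : R)^'] --> a ->
  h^-1 *: (f (h *: v + (h *: u + x)) - f (h *: u + x)) @[h --> (0 : R)^'] --> b ->
  is_derive x (u + v) f (a + b).
Proof.
move=> fu fv; apply/is_deriveP; have H := cvgD (FF := dnbhs_filter _) fu fv.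
apply: (cvg_trans _ H); apply: near_eq_cvg; apply: nearW => h /=.
rewrite -[LHS]/(h^-1 *: (f (h *: u + x) - f x) +
  h^-1 *: (f (h *: v + (h *: u + x)) - f (h *: u + x))).
rewrite -scalerDr addrC subrKA [h *: (u + v)]scalerDr.
by rewrite [h *: u + h *: v]addrC -[h *: v + h *: u + x]addrA.
Qed.

Section SecondDerivatives.
Variables (R : realType) (n : nat) (U : set 'M[R]_n) (S : {vspace 'M[R]_n}).
Hypothesis US : submanifold U S.
Local Notation M := 'M[R]_n.
Implicit Types (f : M -> R^o) (x u v : M).

Definition continuous_in (F : topologicalType) (f : M -> F) x :=
  f y @[y --> within U (nbhs x)] --> f x.

(** By the mean value theorem the increment is h times 'D_v f at a point of
    a small parallelogram around x; the bound is uniform in the base point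
    s u + x of the increment. *)
Lemma directional_increment f x u v : U x -> u \in S -> v \in S ->
  (forall y, U y -> derivable f y v) -> continuous_in ('D_v f) x ->
  forall e : R, 0 < e -> exists2 d : R, 0 < d & forall s h, `|s| <= d ->
    `|h| <= d ->
    `|f (h *: v + (s *: u + x)) - f (s *: u + x) - h * 'D_v f x| <= `|h| * e.
Proof.
move=> Ux Su Sv df cf e e0.
have : \forall y \near within U (nbhs x), `|'D_v f x - 'D_v f y| <= e.
  by move/cvgrPdist_le : cf; exact.
move=> /(within_square US Ux Sv Su)[d d0 H]; exists d => // s h hs hh.
have H' t : `|t| <= 1 -> `|t * h| <= d.
  by move=> t1; rewrite normrM (le_trans _ hh)// ler_piMl.
have [|t t1 ->] := @mvt_direction R _ f (s *: u + x) (h *: v).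
  move=> t /H' th; rewrite scalerA.
  have /df/derivableP dfv := (H _ _ th hs).1.
  by case: (is_deriveZv h dfv).
rewrite scalerA; have [/df/derivableP dfv {}H] := H _ _ (H' t t1) hs.
rewrite (is_deriveE (is_deriveZv h dfv)).
rewrite -[X in `|X|](@mulrBr R h) normrM ler_wpM2l//.
by rewrite distrC.
Qed.

(** Existence of directional derivatives does not imply additivity: the increment
    along v starts from the moving point h u + x, and the continuity of 'D_v f
    compares it with the one that starts from x. *)
Lemma derive_directionD f x u v : U x -> u \in S -> v \in S ->
  derivable f x u -> (forall y, U y -> derivable f y v) ->
  continuous_in ('D_v f) x ->
  is_derive x (u + v) f ('D_u f x + 'D_v f x).
Proof.
move=> Ux Su Sv dfu dfv cf.
have {}dfu := (is_deriveP _ _ _ _).1 (derivableP dfu).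
apply: is_deriveDv dfu _; apply/cvgrPdist_le => e e0.
have [d d0 H] := directional_increment Ux Su Sv dfv cf e0.
near=> h.
have hd : `|h| <= d.
  near: h; apply: nbhs_dnbhs; apply/nbhs_ballP; exists d => //= h.
  by rewrite /ball /= sub0r normrN => /ltW.
have h0 : h != 0 by near: h; exact: nbhs_dnbhs_neq.
rewrite distrC -(@ler_pM2l _ `|h|) ?normr_gt0// -normrM mulrBr.
by rewrite [h^-1 *: _]/(h^-1 * _) mulVKf//; exact: H.
Unshelve. all: by end_near. Qed.

(** Mean value theorem along u for y |-> f (h v + y) - f y, then
    [directional_increment] for 'D_u f along v. *)
Lemma second_difference f x u v : U x -> u \in S -> v \in S ->
  (forall y, U y -> derivable f y u) ->
  (forall y, U y -> derivable ('D_u f) y v) ->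
  continuous_in ('D_v ('D_u f)) x ->
  forall e : R, 0 < e -> exists2 d : R, 0 < d & forall h, `|h| <= d ->
    `|f (h *: v + (h *: u + x)) - f (h *: u + x) - (f (h *: v + x) - f x)
      - h ^+ 2 * 'D_v ('D_u f) x| <= h ^+ 2 * e.
Proof.
move=> Ux Su Sv dfu dfuv cf e e0.
have [d d0 H] := directional_increment Ux Su Sv dfuv cf e0.
have : \forall y \near within U (nbhs x), True by exact: nearW.
move=> /(within_square US Ux Su Sv)[d' d'0 H'].
exists (Num.min d d'); first by rewrite lt_min d0.
move=> h; rewrite le_min => /andP[hd hd'].
pose g y := f (h *: v + y) - f y.
have dg t : `|t| <= 1 -> is_derive (t *: (h *: u) + x) (h *: u) (g : M -> R^o)
    (h *: ('D_u f (h *: v + ((t * h) *: u + x)) - 'D_u f ((t * h) *: u + x))).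
  move=> t1; rewrite scalerA.
  have th : `|t * h| <= d' by rewrite normrM (le_trans _ hd')// ler_piMl.
  have h0 : `|0 : R| <= d' by rewrite normr0 ltW.
  have [U1 _] := H' _ _ th h0; have [U2 _] := H' _ _ th hd'.
  rewrite scale0r add0r in U1; rewrite addrCA in U2.
  have d1 := is_deriveZv h (derivableP (dfu _ U1)).
  have d2 := is_deriveZv h (derivableP (dfu _ U2)).
  rewrite scalerBr; exact: (is_deriveB (is_derive_translate d2) d1).
have [|t t1] := @mvt_direction R _ (g : M -> R^o) x (h *: u).
  by move=> t /dg[].
rewrite (is_deriveE (dg t t1)) /g => ->.
have th : `|t * h| <= d.
  by rewrite normrM (le_trans _ hd)// ler_piMl.
have := H _ _ th hd.
move=> /(ler_wpM2l (normr_ge0 h)).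
rewrite -normrM mulrA -expr2 real_normK ?num_real// mulrBr mulrA -expr2.
by rewrite -mulrA.
Qed.

(** Both mixed derivatives approximate, up to o(h^2), the same second difference
    divided by h^2, whose value is symmetric in u and v. *)
Lemma derive_commute f x u v : U x -> u \in S -> v \in S ->
  (forall w y, w \in S -> U y -> derivable f y w) ->
  (forall y, U y -> derivable ('D_u f) y v) ->
  (forall y, U y -> derivable ('D_v f) y u) ->
  continuous_in ('D_v ('D_u f)) x -> continuous_in ('D_u ('D_v f)) x ->
  'D_v ('D_u f) x = 'D_u ('D_v f) x.
Proof.
move=> Ux Su Sv df duv dvu cuv cvu; apply/eqP; rewrite -subr_eq0 -normr_le0.
apply/ler_addgt0Pl => e e0; rewrite addr0.
have e2 : 0 < e / 2 by rewrite divr_gt0.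
have [d d0 H] := second_difference Ux Su Sv (fun y => df u y Su) duv cuv e2.
have [d' d'0 H'] := second_difference Ux Sv Su (fun y => df v y Sv) dvu cvu e2.
pose h := Num.min d d'.
have h0 : 0 < h by rewrite lt_min d0.
have hE : `|h| = h by rewrite gtr0_norm.
have hd : `|h| <= d by rewrite hE ge_min lexx.
have hd' : `|h| <= d' by rewrite hE ge_min lexx orbT.
have {}H := H _ hd; have {}H' := H' _ hd'.
have hh : 0 < h ^+ 2 by rewrite exprn_gt0.
rewrite -(ler_pM2l hh) -[X in X * `|_|]gtr0_norm// -normrM mulrBr.
move: H H'; rewrite [h *: u + (h *: v + x)]addrCA.
set A := 'D_v _ x; set B := 'D_u _ x.
set a := f _; set b := f _; set c := f _; set k := f x.
have -> : h ^+ 2 * A - h ^+ 2 * B = (a - c - (b - k) - h ^+ 2 * B) -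
   (a - b - (c - k) - h ^+ 2 * A) by ring.
move=> H H'; apply: le_trans (ler_normB _ _) _.
apply: le_trans (lerD H' H) _.
by rewrite -mulrDr -splitr.
Qed.

End SecondDerivatives.

(** * Functions of class C^k along a subspace *)

Lemma is_derive_add (R : realType) (V W : normedModType R) (f g : V -> W)
    (x v : V) df dg :
  is_derive x v f df -> is_derive x v g dg ->
  is_derive x v (fun y => f y + g y) (df + dg).
Proof. by move=> fdf gdg; exact: (is_deriveD fdf gdg). Qed.

Lemma is_derive_bigsum (R : realType) (V W : normedModType R) (I : Type)
    (r : seq I) (f : I -> V -> W) (x v : V) (df : I -> W) :
  (forall i, is_derive x v (f i) (df i)) ->
  is_derive x v (fun y => \sum_(i <- r) f i y) (\sum_(i <- r) df i).
Proof.
move=> H; elim: r => [|i r IHr].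
  have -> : (fun y => \sum_(i <- [::]) f i y) = cst 0.
    by apply/funext => y; rewrite big_nil.
  by rewrite big_nil; exact: is_derive_cst.
have -> : (fun y => \sum_(j <- i :: r) f j y) =
    (fun y => f i y + \sum_(j <- r) f j y).
  by apply/funext => y; rewrite big_cons.
by rewrite big_cons; exact: is_derive_add.
Qed.

Section MatrixFunctions.
Variables (R : realType) (n : nat).
Local Notation M := 'M[R]_n.

(** Valued in R^o, where a coordinate is a linear map of normed modules. *)
Definition entry (i j : 'I_n) (A : M) : R^o := A i j.

Lemma entry_is_linear i j : linear (entry i j).
Proof. by move=> a A B; rewrite /entry !mxE. Qed.
HB.instance Definition _ i j :=
  GRing.isLinear.Build R M R^o _ (entry i j) (entry_is_linear i j).

(** Writes a product with scalings by entries, sums and linear maps only, so that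
    limits and derivatives of products reduce to theirs. *)
Lemma mulmx_entry_sum (A B : M) :
  A *m B = \sum_(ij : 'I_n * 'I_n) entry ij.1 ij.2 A *:
    (delta_mx ij.1 ij.2 *m B).
Proof.
rewrite {1}[A]matrix_sum_delta mulmx_suml -(pair_bigA _
  (fun i j => entry i j A *: (delta_mx i j *m B))) /=.
apply: eq_bigr => i _; rewrite mulmx_suml; apply: eq_bigr => j _.
by rewrite -scalemxAl.
Qed.

Lemma is_derive_mulmx (V : normedModType R) (f g : V -> M) (x v : V) df dg :
  is_derive x v f df -> is_derive x v g dg ->
  is_derive x v (fun y => f y *m g y) (df *m g x + f x *m dg).
Proof.
move=> fdf gdg.
have -> : (fun y => f y *m g y) = fun y => \sum_(ij : 'I_n * 'I_n)
    entry ij.1 ij.2 (f y) *: (delta_mx ij.1 ij.2 *m g y).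
  by apply/funext => y; rewrite -mulmx_entry_sum.
rewrite 2!mulmx_entry_sum -big_split /=.
apply: is_derive_bigsum => -[i j] /=.
apply: is_derive_scale; apply: is_derive_linear => //;
  exact: linear_mx_continuous.
Qed.

End MatrixFunctions.

Section SmoothFunctions.
Variables (R : realType) (n : nat) (U : set 'M[R]_n) (S : {vspace 'M[R]_n}).
Hypothesis US : submanifold U S.
Local Notation M := 'M[R]_n.

Lemma Ck_continuous (F : normedModType R) k (f : M -> F) x :
  Ck U S k f -> U x -> continuous_in U f x.
Proof. by case: k => [|k] /= [/subspace_continuousP fc _] Ux; exact: fc. Qed.

Lemma Ck_derivable (F : normedModType R) k (f : M -> F) x v :
  Ck U S k.+1 f -> U x -> v \in S -> is_derive x v f ('D_v f x).
Proof. by move=> /= [_ fk] Ux Sv; apply: derivableP; exact: (fk v Sv).1. Qed.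

Lemma Ck_derive (F : normedModType R) k (f : M -> F) v :
  Ck U S k.+1 f -> v \in S -> Ck U S k ('D_v f).
Proof. by move=> /= [_ fk] Sv; exact: (fk v Sv).2. Qed.

Lemma continuous_in_ext (F : topologicalType) (f g : M -> F) x :
  (forall y, U y -> f y = g y) -> U x ->
  continuous_in U f x -> continuous_in U g x.
Proof.
move=> fg Ux; rewrite /continuous_in (fg x Ux) => fc.
apply: cvg_trans fc; apply: near_eq_cvg.
by near=> y; apply: fg; near: y; exact: withinT.
Unshelve. all: by end_near. Qed.

Lemma Ck_ext (F : normedModType R) k (f g : M -> F) :
  (forall x, U x -> f x = g x) -> Ck U S k f -> Ck U S k g.
Proof.
elim: k f g => [|k IHk] f g fg fk.
  split=> //; apply/subspace_continuousP => x Ux.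
  exact: continuous_in_ext fg Ux (Ck_continuous fk Ux).
split=> [|v Sv].
  apply/subspace_continuousP => x Ux.
  exact: continuous_in_ext fg Ux (Ck_continuous fk Ux).
split=> [x Ux|].
  by apply: (derivable_ext US Ux Sv fg); case: (Ck_derivable fk Ux Sv).
apply: IHk (Ck_derive fk Sv) => x Ux.
exact: (derive_ext US Ux Sv fg).
Qed.

(** The class C^k is a condition on the functions 'D_v f on the whole space,
    whereas a computation yields them on U only; [Ck_ext] bridges the gap. *)
Lemma Ck_intro (F : normedModType R) k (f : M -> F) (df : M -> M -> F) :
  (forall x, U x -> continuous_in U f x) ->
  (forall x v, U x -> v \in S -> is_derive x v f (df v x)) ->
  (forall v, v \in S -> Ck U S k (df v)) -> Ck U S k.+1 f.
Proof.
move=> fc fd dfk; split=> [|v Sv]; first by apply/subspace_continuousP.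
split=> [x Ux|]; first by case: (fd x v Ux Sv).
apply: Ck_ext (dfk v Sv) => x Ux; have := fd x v Ux Sv.
by move=> H; rewrite (is_deriveE H).
Qed.

Lemma Ck0 (F : normedModType R) (f : M -> F) :
  (forall x, U x -> continuous_in U f x) -> Ck U S 0 f.
Proof. by move=> fc; split=> //; apply/subspace_continuousP. Qed.

Lemma CkW (F : normedModType R) k (f : M -> F) : Ck U S k.+1 f -> Ck U S k f.
Proof.
elim: k f => [|k IHk] f fk; first by case: fk.
apply: (@Ck_intro _ _ _ (fun v => 'D_v f)).
- by move=> x; exact: Ck_continuous fk.
- by move=> x v; exact: Ck_derivable fk.
- by move=> v Sv; apply/IHk/Ck_derive.
Qed.

Lemma Ck_cst (F : normedModType R) k (a : F) : Ck U S k (fun=> a).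
Proof.
elim: k a => [|k IHk] a; first by apply: Ck0 => x _; exact: cvg_cst.
apply: (@Ck_intro _ _ _ (fun _ _ => 0)) => // x _; exact: cvg_cst.
Qed.

Lemma Ck_add (F : normedModType R) k (f g : M -> F) :
  Ck U S k f -> Ck U S k g -> Ck U S k (fun x => f x + g x).
Proof.
elim: k f g => [|k IHk] f g fk gk.
  by apply: Ck0 => x Ux; apply: cvgD; [exact: Ck_continuous fk _|
    exact: Ck_continuous gk _].
apply: (@Ck_intro _ _ _ (fun v x => 'D_v f x + 'D_v g x)).
- by move=> x Ux; apply: cvgD; [exact: Ck_continuous fk _|
    exact: Ck_continuous gk _].
- by move=> x v Ux Sv; apply: is_derive_add; [exact: Ck_derivable fk _ _|
    exact: Ck_derivable gk _ _].
- by move=> v Sv; apply: IHk; exact: Ck_derive.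
Qed.

Lemma Ck_linear (F F' : normedModType R) (L : {linear F -> F'}) k (f : M -> F) :
  continuous L -> Ck U S k f -> Ck U S k (fun x => L (f x)).
Proof.
move=> Lc; elim: k f => [|k IHk] f fk.
  apply: Ck0 => x Ux; exact: (cvg_comp _ _ (Ck_continuous fk Ux) (Lc (f x))).
apply: (@Ck_intro _ _ _ (fun v x => L ('D_v f x))).
- move=> x Ux; exact: (cvg_comp _ _ (Ck_continuous fk Ux) (Lc (f x))).
- by move=> x v Ux Sv; apply: is_derive_linear => //; exact: Ck_derivable fk _ _.
- by move=> v Sv; apply: IHk; exact: Ck_derive.
Qed.

Lemma Ck_linear_mx (F : normedModType R) (L : {linear M -> F}) k (f : M -> M) :
  Ck U S k f -> Ck U S k (fun x => L (f x)).
Proof. by apply: Ck_linear; exact: linear_mx_continuous. Qed.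

Lemma Ck_scale (F : normedModType R) k (f : M -> R^o) (g : M -> F) :
  Ck U S k f -> Ck U S k g -> Ck U S k (fun x => f x *: g x).
Proof.
have c k' (f' : M -> R^o) (g' : M -> F) : Ck U S k' f' -> Ck U S k' g' ->
    forall x, U x -> continuous_in U (fun x => f' x *: g' x) x.
  move=> fk gk x Ux.
  exact: (cvgZ (Ck_continuous fk Ux) (Ck_continuous gk Ux)).
elim: k f g => [|k IHk] f g fk gk; first by apply: Ck0; exact: c fk gk.
apply: (@Ck_intro _ _ _ (fun v x => ('D_v f x : R) *: g x + f x *: 'D_v g x)).
- exact: c fk gk.
- by move=> x v Ux Sv; apply: is_derive_scale; [exact: Ck_derivable fk _ _|
    exact: Ck_derivable gk _ _].
- move=> v Sv; apply: Ck_add; apply: IHk; do ?[exact: Ck_derive|exact: CkW].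
Qed.

Lemma Ck_sum (F : normedModType R) (I : Type) (r : seq I) k (f : I -> M -> F) :
  (forall i, Ck U S k (f i)) -> Ck U S k (fun x => \sum_(i <- r) f i x).
Proof.
move=> fk; elim: r => [|i r IHr].
  by apply: (@Ck_ext _ _ (fun=> 0)); [move=> x _; rewrite big_nil|exact: Ck_cst].
apply: (@Ck_ext _ _ (fun x => f i x + \sum_(j <- r) f j x)).
  by move=> x _; rewrite big_cons.
exact: Ck_add.
Qed.

Lemma Ck_mulmx k (f g : M -> M) :
  Ck U S k f -> Ck U S k g -> Ck U S k (fun x => f x *m g x).
Proof.
move=> fk gk; apply: (@Ck_ext _ _ (fun x => \sum_(ij : 'I_n * 'I_n)
    entry ij.1 ij.2 (f x) *: (delta_mx ij.1 ij.2 *m g x))).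
  by move=> x _; rewrite -mulmx_entry_sum.
by apply: Ck_sum => ij; apply: Ck_scale; apply: Ck_linear_mx.
Qed.

End SmoothFunctions.

(** * Smoothness of the matrix inverse *)

Lemma cvg_near_eq (T W : topologicalType) (f g : T -> W) (x : T) (l : W) :
  (\forall y \near x, f y = g y) -> f @ x --> l -> g @ x --> l.
Proof.
move=> fg; apply: cvg_trans; apply: near_eq_cvg.
by apply: filterS fg.
Qed.

Lemma cvg_linear_mx (R : realType) m n (W : normedModType R)
    (L : {linear 'M[R]_(m, n) -> W}) (T : Type) (F : set_system T)
    (f : T -> 'M[R]_(m, n)) l :
  f @ F --> l -> L (f t) @[t --> F] --> L l.
Proof.
move=> fl; have Lc : L x @[x --> l] --> L l by exact: linear_mx_continuous.
exact: (cvg_comp _ _ fl Lc).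
Qed.

Section Inverse.
Variable R : realType.

Lemma det_continuous m : continuous (fun A : 'M[R]_m => \det A : R^o).
Proof.
apply: continuous_big => [|s _]; first exact: add_continuous.
have pc : continuous (fun A : 'M[R]_m => \prod_i A i ((s : {perm 'I_m}) i) : R^o).
  apply: continuous_big => [|i _]; first exact: mul_continuous.
  exact: coord_continuous.
by move=> A; exact: (cvgM (cvg_cst _) (pc A)).
Qed.

Lemma open_GL n : open (GL R n).
Proof.
have -> : GL R n = (fun A : 'M[R]_n => \det A : R^o) @^-1` [set x | x != 0].
  by apply/seteqP; split=> A; rewrite /GL /= unitmxE unitfE.
apply: open_comp; first by move=> A _; exact: det_continuous.
exact: open_neq.
Qed.

(** Each cofactor is, up to sign, the determinant of a linear image of the
    matrix. *)
Lemma adjugate_continuous n : continuous (fun A : 'M[R]_n => \adj A).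
Proof.
have -> : (fun A : 'M[R]_n => \adj A) =
   fun A => \sum_i \sum_j (\adj A i j) *: delta_mx i j.
  by apply/funext => A; rewrite {1}[\adj A]matrix_sum_delta.
apply: continuous_big => [|i _]; first exact: add_continuous.
apply: continuous_big => [|j _]; first exact: add_continuous.
pose f (B : 'M[R]_n) := row' j (col' i B).
have f_linear : linear f by move=> a B C; apply/matrixP => k l; rewrite !mxE.
pose F := GRing.isLinear.Build R 'M[R]_n 'M[R]_n.-1 *:%R f f_linear.
pose minor : {linear 'M[R]_n -> 'M[R]_n.-1} := HB.pack f F.
have minor_c : continuous (fun B : 'M[R]_n => \det (minor B) : R^o).
  move=> A; apply: continuous_comp; first exact: linear_mx_continuous.
  exact: det_continuous.
have c : continuous (fun B : 'M[R]_n => (\adj B) i j : R^o).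
  have -> : (fun B : 'M[R]_n => (\adj B) i j) =
      fun B => (-1) ^+ (j + i) * \det (minor B).
    by apply/funext => B; rewrite mxE.
  by move=> A; exact: (cvgM (cvg_cst _) (minor_c A)).
by move=> A; exact: (cvgZr_tmp (c A)).
Qed.

Lemma invmx_continuous n (A : 'M[R]_n) : A \in unitmx ->
  {for A, continuous (@invmx R n)}.
Proof.
move=> uA.
have H : (\det B)^-1 *: \adj B @[B --> A] --> (\det A)^-1 *: \adj A.
  have dA : \det A != 0 by rewrite -unitfE -unitmxE.
  exact: (cvgZ (cvgV dA (@det_continuous n A)) (@adjugate_continuous n A)).
have E : invmx A = (\det A)^-1 *: \adj A by rewrite /invmx uA.
suff : invmx B @[B --> A] --> (\det A)^-1 *: \adj A by rewrite -E.
apply: cvg_near_eq H.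
have : \forall B \near A, GL R n B.
  by apply: open_nbhs_nbhs; split => //; exact: open_GL.
by apply: filterS => B; rewrite /GL /= /invmx => ->.
Qed.

Lemma cvg_mulmx n (T : Type) (F : set_system T) (FF : Filter F)
    (f g : T -> 'M[R]_n) (a b : 'M[R]_n) :
  f @ F --> a -> g @ F --> b -> f t *m g t @[t --> F] --> a *m b.
Proof.
move=> fa gb; rewrite mulmx_entry_sum.
have -> : (fun t => f t *m g t) = fun t => \sum_(ij : 'I_n * 'I_n)
    entry ij.1 ij.2 (f t) *: (delta_mx ij.1 ij.2 *m g t).
  by apply/funext => t; rewrite mulmx_entry_sum.
apply: cvg_big => [|ij _]; first exact: add_continuous.
apply: cvgZ; first exact: (cvg_linear_mx (L := entry ij.1 ij.2) fa).
exact: (cvg_linear_mx (L := mulmx (delta_mx ij.1 ij.2)) gb).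
Qed.

(** From B^-1 - A^-1 = - B^-1 (B - A) A^-1 and the continuity of the inverse. *)
Lemma is_derive_invmx_comp (V : normedModType R) n (f : V -> 'M[R]_n) (x v : V)
    df : f x \in unitmx -> is_derive x v f df ->
  is_derive x v (fun y => invmx (f y))
    (- (invmx (f x) *m df *m invmx (f x))).
Proof.
move=> uA fdf; apply/is_deriveP.
have fc : f (h *: v + x) @[h --> (0 : R)^'] --> f x.
  apply: cvg_within_filter; apply: derivable_cvg_line.
  by case: fdf.
have q := (is_deriveP _ _ _ _).1 fdf.
have H : - (invmx (f (h *: v + x)) *m (h^-1 *: (f (h *: v + x) - f x)) *m
    invmx (f x)) @[h --> (0:R)^'] --> - (invmx (f x) *m df *m invmx (f x)).
  apply: cvgN; apply: cvg_mulmx; last exact: cvg_cst.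
  by apply: cvg_mulmx q; exact: (cvg_comp _ _ fc (invmx_continuous uA)).
apply: cvg_trans H; apply: near_eq_cvg.
have gl : nbhs (f x) (GL R n).
  by apply: open_nbhs_nbhs; split => //; exact: open_GL.
have hA : \forall h \near (0 : R)^', GL R n (f (h *: v + x)) by exact: (fc _ gl).
near=> h.
have uh : f (h *: v + x) \in unitmx by near: h; exact: hA.
rewrite /= -scalemxAr -scalemxAl -scalerN; congr (_ *: _).
by rewrite mulmxBr mulmxBl mulVmx// mul1mx -mulmxA mulmxV// mulmx1 opprB.
Unshelve. all: by end_near. Qed.

Lemma is_derive_invmx n (A v : 'M[R]_n) : A \in unitmx ->
  is_derive A v (@invmx R n) (- (invmx A *m v *m invmx A)).
Proof. by move=> uA; apply: (is_derive_invmx_comp uA); exact: is_derive_id. Qed.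

End Inverse.

(** * Derivatives along vector fields *)

Section VectorFields.
Variables (R : realType) (n : nat) (U : set 'M[R]_n) (S : {vspace 'M[R]_n}).
Hypothesis US : submanifold U S.
Local Notation M := 'M[R]_n.

Lemma derive_entry (f : M -> M) x v i j : derivable f x v ->
  'D_v (fun y => entry i j (f y)) x = entry i j ('D_v f x).
Proof.
move=> /derivableP df.
have H := @is_derive_linear _ _ _ _ (entry i j) _ _ _ _
  (@linear_mx_continuous _ _ _ _ _) df.
by rewrite (is_deriveE H).
Qed.

(** Additivity in the direction, proved for scalar functions, is applied to each
    entry. *)
Lemma Ck_derive_linear (f : M -> M) x u v (a : R) :
  Ck U S 1 f -> U x -> u \in S -> v \in S ->
  'D_(a *: u + v) f x = a *: 'D_u f x + 'D_v f x.
Proof.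
move=> f1 Ux Su Sv; have Sau : a *: u \in S by rewrite rpredZ.
have fe i j : Ck U S 1 (fun y => entry i j (f y)) by exact: Ck_linear_mx.
have du := Ck_derivable f1 Ux Su; have dv := Ck_derivable f1 Ux Sv.
have duv := Ck_derivable f1 Ux (rpredD Sau Sv).
have dau := is_deriveZv a du.
rewrite -(is_deriveE dau); apply/matrixP => i j; rewrite mxE.
have e w : derivable f x w ->
    ('D_w f x) i j = 'D_w (fun y => entry i j (f y)) x.
  by move=> dw; rewrite derive_entry.
have [edau _] := dau; have [edv _] := dv; have [eduv _] := duv.
apply: etrans (e _ eduv) _; apply: esym.
apply: etrans (congr2 +%R (e _ edau) (e _ edv)) _; apply: esym.
apply: (is_deriveE (derive_directionD US Ux Sau Sv _ _ _)).
- by case: (Ck_derivable (fe i j) Ux Sau).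
- by move=> y Uy; case: (Ck_derivable (fe i j) Uy Sv).
- exact: Ck_continuous (Ck_derive (fe i j) Sv) Ux.
Qed.

Lemma Ck_derive_commute (f : M -> M) x u v :
  Ck U S 2 f -> U x -> u \in S -> v \in S ->
  'D_v ('D_u f) x = 'D_u ('D_v f) x.
Proof.
move=> f2 Ux Su Sv; apply/matrixP => i j.
have fe : Ck U S 2 (fun y => entry i j (f y)) by exact: Ck_linear_mx.
have H w w' : w \in S -> w' \in S ->
    'D_w' ('D_w f) x i j = 'D_w' ('D_w (fun y => entry i j (f y))) x.
  move=> Sw Sw'; rewrite -[LHS]/(entry i j _) -derive_entry; last first.
    by case: (Ck_derivable (Ck_derive f2 Sw) Ux Sw').
  apply: (derive_ext US Ux Sw') => y Uy; rewrite derive_entry//.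
  by case: (Ck_derivable f2 Uy Sw).
apply: etrans (H u v Su Sv) _; apply: etrans _ (esym (H v u Sv Su)).
apply: (derive_commute US Ux Su Sv).
- by move=> w y Sw Uy; case: (Ck_derivable fe Uy Sw).
- by move=> y Uy; case: (Ck_derivable (Ck_derive fe Su) Uy Sv).
- by move=> y Uy; case: (Ck_derivable (Ck_derive fe Sv) Uy Su).
- exact: Ck_continuous (Ck_derive (Ck_derive fe Su) Sv) Ux.
- exact: Ck_continuous (Ck_derive (Ck_derive fe Sv) Su) Ux.
Qed.

(** In a fixed basis of S, a derivative along a varying direction becomes
    a combination of fixed partial derivatives; this is how smoothness and
    the product rule reach 'D_(X x) f x. *)
Lemma derive_basis (f : M -> M) x v :
  Ck U S 1 f -> U x -> v \in S ->
  'D_v f x = \sum_(i < \dim S) coord (vbasis S) i v *: 'D_((vbasis S)`_i) f x.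
Proof.
move=> f1 Ux Sv; rewrite {1}(coord_vbasis Sv).
have Sb i : (vbasis S)`_i \in S.
  have [iS|Si] := ltnP i (size (vbasis S)).
    by apply: vbasis_mem; exact: mem_nth.
  by rewrite nth_default// rpred0.
move: (index_enum _) => r; elim: r => [|i r IHr]; first by rewrite !big_nil derive0.
rewrite !big_cons Ck_derive_linear ?IHr//.
by apply: rpred_sum => j _; apply: rpredZ; exact: Sb.
Qed.

(** S is the kernel of 1 minus a projection, and linear maps commute with
    derivatives. *)
Lemma derive_mem (f : M -> M) x v : U x -> v \in S ->
  (forall y, U y -> f y \in S) -> derivable f x v -> 'D_v f x \in S.
Proof.
move=> Ux Sv fS /derivableP df.
have SE y : (y \in S) = ((\1 - projv S)%VF y == 0).
  rewrite add_lfunE opp_lfunE id_lfunE subr_eq0 eq_sym.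
  by apply/idP/eqP => [/projv_id|<-]; [|exact: memv_proj].
have H : is_derive x v (fun y => (\1 - projv S)%VF (f y))
    ((\1 - projv S)%VF ('D_v f x)).
  by apply: is_derive_linear df; exact: linear_mx_continuous.
have {}H : 'D_v (fun y => (\1 - projv S)%VF (f y)) x = (\1 - projv S)%VF ('D_v f x).
  by rewrite (is_deriveE H).
rewrite SE -H (@derive_ext _ _ _ _ US _ _ (cst 0)) ?derive_cst//.
by move=> y /fS; rewrite SE => /eqP.
Qed.

Lemma smooth_derive_along (X f : M -> M) :
  vector_field U S X -> smooth U S f -> smooth U S (fun x => 'D_(X x) f x).
Proof.
move=> [XS Xs] fs k.
apply: (@Ck_ext _ _ _ _ US _ _ (fun x => \sum_(i < \dim S)
   (coord (vbasis S) i (X x) : R^o) *: 'D_((vbasis S)`_i) f x)).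
  by move=> x Ux; rewrite -derive_basis//; exact: XS.
apply: Ck_sum => // i; apply: Ck_scale => //.
  by apply: Ck_linear_mx.
apply: Ck_derive (fs k.+1) _; apply: vbasis_mem; apply: mem_nth.
by rewrite size_tuple.
Qed.

(** Product rule in the expansion of 'D_(Y y) f y in a basis of S: differentiating
    the coordinates of Y gives the first term, differentiating the partial
    derivatives of f gives the second. *)
Lemma derive_along_derive (Y f : M -> M) x v :
  vector_field U S Y -> smooth U S f -> U x -> v \in S ->
  'D_v (fun y => 'D_(Y y) f y) x = 'D_('D_v Y x) f x + 'D_v ('D_(Y x) f) x.
Proof.
move=> [YS Ys] fs Ux Sv.
have Sb (i : 'I_(\dim S)) : (vbasis S)`_i \in S.
  by apply: vbasis_mem; apply: mem_nth; rewrite size_tuple.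
have f1 := fs 1%N.
have E w : w \in S -> forall y, U y -> 'D_w f y = \sum_(i < \dim S)
    (coord (vbasis S) i w : R^o) *: 'D_((vbasis S)`_i) f y.
  by move=> Sw y Uy; rewrite -derive_basis.
have dY := Ck_derivable (Ys 1%N) Ux Sv.
have D1 : is_derive x v (fun y => \sum_(i < \dim S)
    (coord (vbasis S) i (Y y) : R^o) *: 'D_((vbasis S)`_i) f y)
  (\sum_(i < \dim S) ((coord (vbasis S) i ('D_v Y x) : R^o) *:
     'D_((vbasis S)`_i) f x + (coord (vbasis S) i (Y x) : R^o) *:
     'D_v ('D_((vbasis S)`_i) f) x)).
  apply: is_derive_bigsum => i; apply: is_derive_scale.
    by apply: is_derive_linear => //; exact: linear_mx_continuous.
  exact: (Ck_derivable (Ck_derive (fs 2) (Sb i)) Ux Sv).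
have D2 : is_derive x v (fun y => \sum_(i < \dim S)
    (coord (vbasis S) i (Y x) : R^o) *: 'D_((vbasis S)`_i) f y)
  (\sum_(i < \dim S) (coord (vbasis S) i (Y x) : R^o) *:
     'D_v ('D_((vbasis S)`_i) f) x).
  apply: is_derive_bigsum => i; apply: is_deriveZ.
  exact: (Ck_derivable (Ck_derive (fs 2) (Sb i)) Ux Sv).
have E1 := derive_ext US Ux Sv (fun y Uy => E (Y y) (YS y Uy) y Uy).
have E2 := derive_ext US Ux Sv (E (Y x) (YS x Ux)).
apply: etrans E1 _; apply: etrans (congr2 +%R erefl (esym E2)).
rewrite (is_deriveE D1) (is_deriveE D2).
have SdY : 'D_v Y x \in S by apply: derive_mem => //; case: dY.
rewrite (E _ SdY x Ux).
by rewrite -big_split.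
Qed.

Hypothesis UGL : U `<=` GL R n.

(** Induction on k, since the derivative - x^-1 v x^-1 is a polynomial in
    the inverse. *)
Lemma Ck_invmx k : Ck U S k (@invmx R n).
Proof.
have c x : U x -> continuous_in U (@invmx R n) x.
  by move=> /UGL ux; apply: cvg_within_filter; exact: invmx_continuous.
elim: k => [|k IHk]; first exact: Ck0.
apply: (@Ck_intro _ _ _ _ US _ _ _
  (fun v x => (-1 : R^o) *: (invmx x *m v *m invmx x))).
- exact: c.
- by move=> x v Ux Sv; rewrite scaleN1r; apply: is_derive_invmx; exact: UGL.
- move=> v Sv; apply: Ck_scale => //; first exact: Ck_cst.
  by do 2?apply: Ck_mulmx => //; exact: Ck_cst.
Qed.

End VectorFields.

(** * Trace identities *)

Lemma half_scale_add (R : realFieldType) (V : lmodType R) (v : V) :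
  2^-1 *: v + 2^-1 *: v = v.
Proof. by rewrite -scalerDl (_ : 2^-1 + 2^-1 = 1) ?scale1r//; lra. Qed.

Section TraceAlgebra.
Variables (R : realFieldType) (n : nat).
Local Notation M := 'M[R]_n.
Implicit Types A B C D I X Y Z W : M.

Lemma mxtraceN A : \tr (- A) = - \tr A.
Proof. by rewrite -scaleN1r mxtraceZ mulN1r. Qed.

Definition mulmx_expand := (@mulmxDl R n n n, @mulmxDr R n n n, @mulNmx R n n n,
  @mulmxN R n n n, @mulmxA R n n n n).
Definition trace_expand := (@mxtraceD R n, mxtraceN, @mxtraceZ R n).

(** With I the inverse of the base point, the left-hand side is the derivative of
    tr (I Y I Z) along X.  The terms without derivative of Y or Z on
    the right-hand side are halves of the same two traces up to
    a cyclic permutation. *)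
Lemma trace_product_rule I X Y Z dY dZ :
  \tr (((- (I *m X *m I) *m Y + I *m dY) *m I + I *m Y *m - (I *m X *m I)) *m Z +
       I *m Y *m I *m dZ) =
  \tr (I *m (dY - 2^-1 *: (X *m I *m Y + Y *m I *m X)) *m I *m Z) +
  \tr (I *m Y *m I *m (dZ - 2^-1 *: (X *m I *m Z + Z *m I *m X))).
Proof.
rewrite !mulmx_expand -?scalemxAl -?scalemxAr !mulmx_expand.
rewrite -?scalemxAl -?scalemxAr !trace_expand.
rewrite ?mulmx_expand.
have -> : \tr (I *m Y *m I *m Z *m I *m X) = \tr (I *m X *m I *m Y *m I *m Z).
  by rewrite -[_ *m I *m X]mulmxA mxtrace_mulC !mulmxA.
lra.
Qed.

(** Covariant derivative along v of a field with value w and derivative dw along v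
    at the inverse of I. *)
Definition covariant_value I v dw w : M :=
  dw - 2^-1 *: (v *m I *m w + w *m I *m v).

(** Terms of a second covariant derivative: d is the derivative along X of
    the first covariant derivative along Y, and e is the derivative of Z
    along Y. *)
Lemma nested_covariant_value I X Y Z d e :
  covariant_value I X d (covariant_value I Y e Z) =
  d - 2^-1 *: (X *m I *m e + e *m I *m X) +
    4^-1 *: (X *m I *m Y *m I *m Z + X *m I *m Z *m I *m Y +
             Y *m I *m Z *m I *m X + Z *m I *m Y *m I *m X).
Proof.
rewrite /covariant_value -addrA; congr (_ + _).
rewrite mulmxBr !mulmxBl -!scalemxAr -!scalemxAl.
rewrite addrACA -opprD scalerBr opprB addrC -scalerDr scalerA.
have -> : 2^-1 * 2^-1 = 4^-1 :> R by lra.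
by rewrite mulmxDr !mulmxDl !mulmxA !addrA [LHS]addrC.
Qed.

(** The algebra behind the curvature.  I is the inverse of the base point, dXY
    is the derivative of Y along X, and so on; dZ1 and dZ2 are the derivatives
    of Z along dXY and dYX, and h is the second derivative of Z in
    the directions X and Y, common to both orders of differentiation.  dGamma v is
    the derivative along v of a I b + b I a. *)
Lemma curvature_trace I X Y Z W dXY dYX dXZ dYZ dZ1 dZ2 h :
  let nabla := covariant_value I in
  let dGamma v a da b db :=
     (da *m I *m b - a *m I *m v *m I *m b + a *m I *m db) +
     (db *m I *m a - b *m I *m v *m I *m a + b *m I *m da) in
  \tr (I *m (nabla (dXY - dYX) (dZ1 - dZ2) Z
     - nabla X ((dZ1 + h) - 2^-1 *: dGamma X Y dXY Z dXZ) (nabla Y dYZ Z)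
     + nabla Y ((dZ2 + h) - 2^-1 *: dGamma Y X dYX Z dYZ) (nabla X dXZ Z))
     *m I *m W) =
  4^-1 * \tr ((I *m X *m (I *m Y) - I *m Y *m (I *m X)) *m
              (I *m Z *m (I *m W) - I *m W *m (I *m Z))).
Proof.
rewrite /= !nested_covariant_value /covariant_value.
pose T (v : M) : R := \tr (I *m v *m I *m W).
have TD u v : T (u + v) = T u + T v by rewrite /T mulmxDr !mulmxDl mxtraceD.
have TN u : T (- u) = - T u by rewrite /T mulmxN !mulNmx mxtraceN.
have TZ a u : T (a *: u) = a * T u.
  by rewrite /T -scalemxAr -!scalemxAl mxtraceZ.
have -> : \tr ((I *m X *m (I *m Y) - I *m Y *m (I *m X)) *m
              (I *m Z *m (I *m W) - I *m W *m (I *m Z))) =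
    T (X *m I *m Y *m I *m Z) - T (Y *m I *m X *m I *m Z) -
    (T (Z *m I *m X *m I *m Y) - T (Z *m I *m Y *m I *m X)).
  rewrite mulmxBr !mulmxBl /T !(mxtraceD, mxtraceN) !mulmxA.
  have cyc A : \tr (A *m I *m Z) = \tr (I *m Z *m A).
    by rewrite -mulmxA mxtrace_mulC.
  by rewrite !cyc !mulmxA.
rewrite -[\tr (I *m _ *m I *m W)]/(T _).
rewrite [(dXY - dYX) *m I]mulmxBl [(_ - _) *m Z]mulmxBl [Z *m I *m (_ - _)]mulmxBr.
rewrite !(TD, TN, TZ).
lra.
Qed.

End TraceAlgebra.

(** * Uniqueness of the Levi-Civita connection *)

Section Uniqueness.
Variables (R : realType) (n : nat) (U : set 'M[R]_n) (S : {vspace 'M[R]_n}).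
Variable (g : 'M[R]_n -> 'M[R]_n -> 'M[R]_n -> R).
Hypothesis US : submanifold U S.
Hypothesis Hg : semi_riemannian_metric U S g.
Local Notation M := 'M[R]_n.

Lemma vector_field_cst w : w \in S -> vector_field U S (fun=> w).
Proof. by move=> Sw; split=> // k; exact: Ck_cst. Qed.

(** If d is the difference of two Levi-Civita connections, then g (d X Y) Z is
    symmetric in X, Y and antisymmetric in Y, Z.  Applying the two symmetries
    alternately, three times each, shows that it is its own opposite. *)
Lemma levi_civita_unique nb nb' X Y x :
  is_levi_civita U S g nb -> is_levi_civita U S g nb' ->
  vector_field U S X -> vector_field U S Y -> U x ->
  nb X Y x = nb' X Y x.
Proof.
case: Hg => lin sym nondeg _ _ [[nbS _ _ _] nbT nbM] [[nbS' _ _ _] nbT' nbM'].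
move=> XF YF Ux.
pose d V W := nb V W x - nb' V W x.
have dS V W : vector_field U S V -> vector_field U S W -> d V W \in S.
  by move=> VF WF; rewrite rpredB//; [exact: (nbS _ _ VF WF).1|
    exact: (nbS' _ _ VF WF).1].
have dC V W : vector_field U S V -> vector_field U S W -> d V W = d W V.
  move=> VF WF; rewrite /d; have := nbT _ _ VF WF x Ux.
  rewrite -(nbT' _ _ VF WF x Ux) => E.
  rewrite -(subrK (nb W V x) (nb V W x)) E addrC -addrA.
  by rewrite addKr addrC.
have gB u v w : u \in S -> v \in S -> w \in S ->
    g x (u - v) w = g x u w - g x v w.
  by move=> Su Sv Sw; rewrite addrC -scaleN1r lin// mulN1r addrC.
have dg V W Z : vector_field U S V -> vector_field U S W ->
    vector_field U S Z -> g x (d V W) (Z x) = - g x (d V Z) (W x).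
  move=> VF WF ZF.
  have VW := (nbS _ _ VF WF).1 x Ux; have VW' := (nbS' _ _ VF WF).1 x Ux.
  have VZ := (nbS _ _ VF ZF).1 x Ux; have VZ' := (nbS' _ _ VF ZF).1 x Ux.
  have WS := WF.1 x Ux; have ZS := ZF.1 x Ux.
  have := nbM _ _ _ VF WF ZF x Ux; rewrite (nbM' _ _ _ VF WF ZF x Ux).
  rewrite !gB// (sym _ Ux (W x))// (sym _ Ux (W x))//.
  lra.
apply/eqP; rewrite -subr_eq0; apply/eqP/(nondeg x Ux); first exact: dS.
move=> w Sw; have wF := vector_field_cst Sw.
suff : g x (d X Y) w = - g x (d X Y) w by rewrite -/(d X Y); lra.
rewrite {1}(dg _ _ _ XF YF wF) (dC _ _ XF wF) (dg _ _ _ wF XF YF) opprK.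
by rewrite (dC _ _ wF YF) (dg _ _ _ YF wF XF) (dC _ _ YF XF).
Qed.

End Uniqueness.

(** * Connection and curvature of the trace metric *)

Section TraceConnection.
Variables (R : realType) (n : nat) (U : set 'M[R]_n) (S : {vspace 'M[R]_n}).
Hypothesis US : submanifold U S.
Hypothesis UGL : U `<=` GL R n.
Local Notation M := 'M[R]_n.
Local Notation g := (@trace_metric R n).
Hypothesis Hg : semi_riemannian_metric U S g.

(** Minus twice the Christoffel form of the trace metric at A: twice the Jordan
    product of u and v in the algebra with product u A^-1 v. *)
Definition jordan (A u v : M) : M := u *m invmx A *m v + v *m invmx A *m u.
Hypothesis jordanS : forall A u v, U A -> u \in S -> v \in S -> jordan A u v \in S.

Definition trace_connection (X Y : M -> M) (x : M) : M :=
  'D_(X x) Y x - 2^-1 *: jordan x (X x) (Y x).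

Lemma vector_field_derivable X x v :
  vector_field U S X -> U x -> v \in S -> is_derive x v X ('D_v X x).
Proof. by move=> [_ Xs] Ux Sv; exact: Ck_derivable (Xs 1%N) Ux Sv. Qed.

Lemma vector_field_derive_mem X x v :
  vector_field U S X -> U x -> v \in S -> 'D_v X x \in S.
Proof.
move=> XF Ux Sv; apply: (derive_mem US Ux Sv XF.1).
by case: (vector_field_derivable XF Ux Sv).
Qed.

Lemma smooth_jordan (X Y : M -> M) : smooth U S X -> smooth U S Y ->
  smooth U S (fun x => jordan x (X x) (Y x)).
Proof.
move=> Xs Ys k; apply: Ck_add => //; apply: Ck_mulmx => //;
  by apply: Ck_mulmx => //; exact: Ck_invmx.
Qed.

Lemma smooth_opp (X : M -> M) : smooth U S X -> smooth U S (fun x => - X x).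
Proof.
move=> Xs k; apply: (@Ck_ext _ _ _ _ US _ _ (fun x => (-1 : R^o) *: X x)).
  by move=> x _; rewrite scaleN1r.
by apply: Ck_scale => //; exact: Ck_cst.
Qed.

Lemma vector_field_trace_connection X Y :
  vector_field U S X -> vector_field U S Y ->
  vector_field U S (trace_connection X Y).
Proof.
move=> XF YF; split=> [x Ux|k].
  rewrite rpredB//; first by apply: vector_field_derive_mem => //; exact: XF.1.
  by rewrite rpredZ// jordanS//; [exact: XF.1 | exact: YF.1].
apply: Ck_add => //; first exact: smooth_derive_along YF.2 k.
apply: (smooth_opp (X := fun x => 2^-1 *: jordan x (X x) (Y x))) => {}k.
apply: (Ck_scale US (f := fun=> 2^-1 : R^o)); first exact: Ck_cst.
exact: smooth_jordan XF.2 YF.2 k.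
Qed.

Lemma jordanDl A u v w : jordan A (u + v) w = jordan A u w + jordan A v w.
Proof. by rewrite /jordan !mulmxDl mulmxDr addrACA. Qed.

Lemma jordanZl A a u w : jordan A (a *: u) w = a *: jordan A u w.
Proof. by rewrite /jordan -!scalemxAl -scalemxAr scalerDr. Qed.

Lemma jordanC A u v : jordan A u v = jordan A v u.
Proof. by rewrite /jordan addrC. Qed.

Lemma trace_connection_metric X Y Z x : vector_field U S X ->
  vector_field U S Y -> vector_field U S Z -> U x ->
  'D_(X x) ((fun y => g y (Y y) (Z y)) : M -> R^o) x =
    g x (trace_connection X Y x) (Z x) + g x (Y x) (trace_connection X Z x).
Proof.
move=> XF YF ZF Ux; have SX := XF.1 x Ux.
have dI := is_derive_invmx (X x) (UGL Ux).
have dY := vector_field_derivable YF Ux SX.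
have dZ := vector_field_derivable ZF Ux SX.
have D := is_derive_mulmx (is_derive_mulmx (is_derive_mulmx dI dY) dI) dZ.
have {}D := is_derive_linear (L := @mxtrace R n) (@linear_mx_continuous _ _ _ _ _) D.
rewrite (is_deriveE D) /trace_metric /trace_connection /jordan.
exact: trace_product_rule.
Qed.

Lemma trace_connection_levi_civita : is_levi_civita U S g trace_connection.
Proof.
split; [split| |].
- exact: vector_field_trace_connection.
- move=> f X Y Z fs XF YF ZF x Ux; rewrite /trace_connection.
  rewrite (Ck_derive_linear US _ (ZF.2 1%N))//; [|exact: XF.1|exact: YF.1].
  by rewrite jordanDl jordanZl scalerBr !scalerDr opprD addrACA !scalerA mulrC.
- move=> a X Y Z XF YF ZF x Ux; rewrite /trace_connection.
  have SX := XF.1 x Ux.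
  have D := is_derive_add (is_deriveZ a (vector_field_derivable YF Ux SX))
    (vector_field_derivable ZF Ux SX).
  rewrite (is_deriveE D) ![jordan x (X x) _]jordanC.
  by rewrite jordanDl jordanZl scalerBr !scalerDr opprD addrACA !scalerA mulrC.
- move=> f X Y fs XF YF x Ux; rewrite /trace_connection.
  have SX := XF.1 x Ux.
  have D := is_derive_scale (Ck_derivable (fs 1%N) Ux SX)
     (vector_field_derivable YF Ux SX).
  rewrite (is_deriveE D) ![jordan x (X x) _]jordanC.
  by rewrite jordanZl scalerBr -!addrA !scalerA mulrC.
- move=> X Y XF YF x Ux; rewrite /trace_connection /lie_bracket jordanC.
  by rewrite opprB addrA subrK.
- by move=> X Y Z XF YF ZF x Ux; exact: trace_connection_metric.
Qed.

Lemma levi_civitaP : is_levi_civita U S g (levi_civita U S g).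
Proof.
apply: (@xgetPex _ _ [set nb | is_levi_civita U S g nb]).
by exists trace_connection; exact: trace_connection_levi_civita.
Qed.

Lemma levi_civitaE X Y x : vector_field U S X -> vector_field U S Y -> U x ->
  levi_civita U S g X Y x = trace_connection X Y x.
Proof.
exact: (levi_civita_unique US Hg levi_civitaP trace_connection_levi_civita).
Qed.

Lemma christoffelE x u v : U x -> u \in S -> v \in S ->
  christoffel U S g x u v = - (2^-1 *: jordan x u v).
Proof.
move=> Ux Su Sv; rewrite /christoffel levi_civitaE//; try exact: vector_field_cst.
by rewrite /trace_connection derive_cst sub0r.
Qed.

Lemma is_derive_jordan X Y x v : vector_field U S X ->
  vector_field U S Y -> U x -> v \in S ->
  is_derive x v (fun y => jordan y (X y) (Y y))
    (('D_v X x *m invmx x *m Y x - X x *m invmx x *m v *m invmx x *m Y x +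
      X x *m invmx x *m 'D_v Y x) +
     ('D_v Y x *m invmx x *m X x - Y x *m invmx x *m v *m invmx x *m X x +
      Y x *m invmx x *m 'D_v X x)).
Proof.
move=> XF YF Ux Sv; have dI := is_derive_invmx v (UGL Ux).
have dX := vector_field_derivable XF Ux Sv.
have dY := vector_field_derivable YF Ux Sv.
have D := is_derive_add (is_derive_mulmx (is_derive_mulmx dX dI) dY)
  (is_derive_mulmx (is_derive_mulmx dY dI) dX).
apply: (is_derive_eq D).
by rewrite !(mulmxDl, mulmxN, mulNmx, mulmxA).
Qed.

Lemma vector_field_lie_bracket X Y : vector_field U S X ->
  vector_field U S Y -> vector_field U S (lie_bracket X Y).
Proof.
move=> XF YF; split=> [x Ux|k].
  by rewrite rpredB//; apply: vector_field_derive_mem => //;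
    [exact: XF.1|exact: YF.1].
apply: Ck_add => //; first exact: smooth_derive_along YF.2 k.
by apply: smooth_opp; apply: smooth_derive_along XF.2.
Qed.

Lemma derive_trace_connection X Y Z x : vector_field U S X ->
  vector_field U S Y -> vector_field U S Z -> U x ->
  'D_(X x) (trace_connection Y Z) x =
    ('D_('D_(X x) Y x) Z x + 'D_(X x) ('D_(Y x) Z) x) - 2^-1 *:
    (('D_(X x) Y x *m invmx x *m Z x - Y x *m invmx x *m X x *m invmx x *m Z x +
      Y x *m invmx x *m 'D_(X x) Z x) +
     ('D_(X x) Z x *m invmx x *m Y x - Z x *m invmx x *m X x *m invmx x *m Y x +
      Z x *m invmx x *m 'D_(X x) Y x)).
Proof.
move=> XF YF ZF Ux; have SX := XF.1 x Ux.
have dG := is_derive_jordan YF ZF Ux SX.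
have dD : is_derive x (X x) (fun y => 'D_(Y y) Z y)
    ('D_('D_(X x) Y x) Z x + 'D_(X x) ('D_(Y x) Z) x).
  rewrite -(derive_along_derive US YF ZF.2 Ux SX).
  exact: (Ck_derivable (smooth_derive_along US YF ZF.2 1) Ux SX).
have D := is_derive_add dD (is_deriveN (is_deriveZ 2^-1 dG)).
by rewrite (is_deriveE D).
Qed.

(** The explicit connection is inserted in each covariant derivative; the outer
    ones differentiate the inner ones along U, where these are known.
    The symmetry of second derivatives then reduces the claim to
    [curvature_trace]. *)
Lemma riemann4E X Y Z W x : vector_field U S X -> vector_field U S Y ->
  vector_field U S Z -> U x ->
  riemann4 U S g X Y Z W x = 4^-1 *
    \tr (commutator (invmx x *m X x) (invmx x *m Y x) *m
         commutator (invmx x *m Z x) (invmx x *m W x)).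
Proof.
move=> XF YF ZF Ux; have SX := XF.1 x Ux; have SY := YF.1 x Ux.
have [[nF _ _ _] _ _] := levi_civitaP.
have dnb V V' : vector_field U S V -> vector_field U S V' ->
    levi_civita U S g V (levi_civita U S g V' Z) x =
    trace_connection V (trace_connection V' Z) x.
  move=> VF VF'; rewrite levi_civitaE//; last exact: nF.
  rewrite /trace_connection (levi_civitaE VF' ZF Ux).
  rewrite (derive_ext US Ux (VF.1 x Ux) (g := trace_connection V' Z))//.
  by move=> y Uy; rewrite levi_civitaE.
rewrite /riemann4 /riemann !dnb// levi_civitaE//; last first.
  exact: vector_field_lie_bracket.
rewrite {2 4}/trace_connection !derive_trace_connection//.
rewrite (Ck_derive_commute US (ZF.2 2) Ux SX SY).
rewrite /trace_connection /jordan.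
have -> : 'D_(lie_bracket X Y x) Z x =
    'D_('D_(X x) Y x) Z x - 'D_('D_(Y x) X x) Z x.
  rewrite /lie_bracket addrC -scaleN1r (Ck_derive_linear US _ (ZF.2 1%N))//;
    try exact: vector_field_derive_mem.
  by rewrite scaleN1r addrC.
exact: curvature_trace.
Qed.

End TraceConnection.

(** * Spectral theorem for real symmetric matrices *)

Section SquaredNorm.
Variable R : realDomainType.

Definition sqnorm n (u : 'rV[R]_n) : R := \sum_i u 0 i ^+ 2.

Lemma sqnormE n (u : 'rV[R]_n) : (u *m u^T) 0 0 = sqnorm u.
Proof. by rewrite mxE; apply: eq_bigr => i _; rewrite mxE expr2. Qed.

Lemma sqnorm_ge0 n (u : 'rV[R]_n) : 0 <= sqnorm u.
Proof. by apply: sumr_ge0 => i _; exact: sqr_ge0. Qed.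

Lemma sqnorm_eq0 n (u : 'rV[R]_n) : (sqnorm u == 0) = (u == 0).
Proof.
rewrite psumr_eq0 => [|i _]; last exact: sqr_ge0.
apply/allP/eqP => [u0|-> i _]; last by rewrite /= mxE expr0n.
apply/rowP => i; rewrite mxE; apply/eqP.
by have := u0 i (mem_index_enum _); rewrite /= sqrf_eq0.
Qed.

Lemma sqnorm_gt0 n (u : 'rV[R]_n) : (0 < sqnorm u) = (u != 0).
Proof. by rewrite lt_def sqnorm_eq0 sqnorm_ge0 andbT. Qed.

Lemma sqnormZ n (c : R) (u : 'rV[R]_n) : sqnorm (c *: u) = c ^+ 2 * sqnorm u.
Proof.
by rewrite /sqnorm mulr_sumr; apply: eq_bigr => i _; rewrite mxE exprMn.
Qed.

End SquaredNorm.

Section Spectral.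
Variable R : rcfType.

(** Let a + i b be a complex eigenvalue.  Then N = (A - a)^2 + b^2 is singular
    over the complex numbers, hence over the reals.  If v N = 0 with v real,
    the symmetry of A gives |v (A - a)|^2 + b^2 |v|^2 = 0, so v is
    an eigenvector for a. *)
Lemma symmetric_eigenvector n (A : 'M[R]_n.+1) : A^T = A ->
  exists a, exists2 v : 'rV_n.+1, v != 0 & v *m A = a *: v.
Proof.
move=> As; pose f := [the {rmorphism R -> R[i]} of real_complex R].
have [l /eigenvalueP[z zA z0]] := eigenvalue_closed (map_mx f A) (ltn0Sn n).
pose a := complex.Re l; pose b := complex.Im l.
pose N := (A - a%:M) *m (A - a%:M) + (b ^+ 2)%:M.
have zN : z *m map_mx f N = 0.
  rewrite map_mxD map_mxM map_mxB !map_scalar_mx mulmxDr mulmxA.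
  have zl : z *m (map_mx f A - (f a)%:M) = (l - f a) *: z.
    by rewrite mulmxBr zA mul_mx_scalar scalerBl.
  rewrite zl -scalemxAl zl scalerA mul_mx_scalar -scalerDl.
  suff -> : (l - f a) * (l - f a) + f (b ^+ 2) = 0 by rewrite scale0r.
  rewrite /a /b; case: (l) => x y /=; rewrite /f /=; simpc.
  by rewrite expr2 addNr.
have : \det (map_mx f N) == 0 by apply/det0P; exists z.
rewrite det_map_mx fmorph_eq0 => /det0P[v v0 vN].
exists a, v => //; apply/eqP; rewrite -subr_eq0 -mul_mx_scalar -mulmxBr.
set w := v *m _; rewrite -sqnorm_eq0.
have H : sqnorm w + b ^+ 2 * sqnorm v = 0.
  have Bs : (A - a%:M)^T = A - a%:M by rewrite linearB /= As tr_scalar_mx.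
  have := congr1 (fun u => (u *m v^T) 0 0) vN.
  rewrite mul0mx [RHS]mxE mulmxDr mulmxDl mul_mx_scalar -scalemxAl => <-.
  by rewrite -!sqnormE /w trmx_mul Bs !mulmxA [RHS]mxE [X in _ = _ + X]mxE.
rewrite eq_le sqnorm_ge0 andbT.
have := mulr_ge0 (sqr_ge0 b) (sqnorm_ge0 v); lra.
Qed.

(** Householder reflection exchanging u with the first basis vector. *)
Lemma orthogonal_first_row n (u : 'rV[R]_n.+1) : sqnorm u = 1 ->
  exists H : 'M[R]_n.+1, [/\ H^T = H, H *m H = 1%:M & delta_mx 0 0 *m H = u].
Proof.
move=> u1; pose e : 'rV[R]_n.+1 := delta_mx 0 0; pose w := e - u.
have [w0|wn0] := eqVneq w 0.
  exists 1%:M; rewrite trmx1 mulmx1; split=> //.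
  by apply/eqP; rewrite -subr_eq0 mulmx1 -/e -/w w0.
have q0 : sqnorm w != 0 by rewrite sqnorm_eq0.
(* the reflection along w maps e to e - w = u, as |e| = |u| *)
pose c := 2 / sqnorm w.
exists (1%:M - c *: (w^T *m w)); split.
- by rewrite linearB linearZ /= trmx1 trmx_mul trmxK.
- have ww : w *m w^T = (sqnorm w)%:M by rewrite [LHS]mx11_scalar sqnormE.
  set P := c *: (w^T *m w).
  have PP : P *m P = P + P.
    rewrite /P -scalemxAl -scalemxAr mulmxA -(mulmxA w^T) ww mul_mx_scalar.
    rewrite -scalemxAl !scalerA -scalerDl; congr (_ *: _).
    by rewrite /c; field.
  by rewrite mulmxBl mul1mx mulmxBr mulmx1 PP opprB addrK subrK.
- rewrite -/e mulmxBr mulmx1 -scalemxAr mulmxA.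
  have -> : e *m w^T = (sqnorm w / 2)%:M.
    rewrite [LHS]mx11_scalar; congr (_%:M).
    have ee : e *m e^T = 1%:M.
      by rewrite trmx_delta mul_delta_mx; apply/matrixP => i j; rewrite !ord1 !mxE.
    have uu : u *m u^T = 1%:M by rewrite [LHS]mx11_scalar sqnormE u1.
    have sym : u *m e^T = e *m u^T.
      by apply/matrixP => i j; rewrite !ord1 -[in RHS](trmxK e) -trmx_mul [RHS]mxE.
    have wt : w^T = e^T - u^T by rewrite /w linearB.
    rewrite -sqnormE wt !mulmxBr /w !mulmxBl ee uu sym.
    by move: (e *m u^T) => x; rewrite !mxE eqxx mulr1n; field.
  rewrite mul_scalar_mx scalerA.
  have -> : c * (sqnorm w / 2) = 1 by rewrite /c; field.
  by rewrite scale1r /w opprB addrC subrK.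
Qed.

Lemma symmetric_split_first n (B : 'M[R]_(1 + n)) a : B^T = B ->
  delta_mx 0 0 *m B = a *: (delta_mx 0 0 : 'rV_(1 + n)) ->
  B = block_mx a%:M 0 0 (drsubmx B).
Proof.
move=> Bt B0; have r0 j : B 0 j = a *+ (j == 0).
  have := congr1 (fun r : 'rV_(1 + n) => r 0 j) B0.
  by rewrite -rowE !mxE eqxx /= mulr_natr eq_sym.
have c0 i : B i 0 = a *+ (i == 0) by rewrite -Bt mxE r0.
have l0 : lshift n (0 : 'I_1) = 0 by exact: val_inj.
rewrite -[LHS]submxK; congr block_mx.
- by apply/matrixP => i j; rewrite !ord1 !mxE l0 r0.
- by apply/matrixP => i j; rewrite !ord1 !mxE l0 r0.
- by apply/matrixP => i j; rewrite !ord1 !mxE l0 c0.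
Qed.

(** A reflection takes a unit eigenvector to the first basis vector, which splits
    off a block of size one; then induction. *)
Lemma symmetric_spectral n (A : 'M[R]_n) : A^T = A ->
  exists (O : 'M[R]_n) (d : 'rV[R]_n),
    O *m O^T = 1%:M /\ A = O^T *m diag_mx d *m O.
Proof.
elim: n A => [|n IHn] A As.
  by exists 1%:M, 0; split; apply/matrixP => -[].
have [a [v v0 vA]] := symmetric_eigenvector As.
have v2 : 0 < sqnorm v by rewrite sqnorm_gt0.
pose u := (Num.sqrt (sqnorm v))^-1 *: v.
have u1 : sqnorm u = 1.
  by rewrite sqnormZ exprVn sqr_sqrtr ?mulVf ?gt_eqF// ltW.
have uA : u *m A = a *: u by rewrite /u -scalemxAl vA !scalerA mulrC.
have [H [Ht HH eH]] := orthogonal_first_row u1.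
pose B : 'M[R]_(1 + n) := H *m A *m H.
have Bt : B^T = B by rewrite /B !trmx_mul Ht As mulmxA.
have uH : u *m H = delta_mx 0 0 by rewrite -eH -mulmxA HH mulmx1.
have B0 : delta_mx 0 0 *m B = a *: (delta_mx 0 0 : 'rV_(1 + n)).
  by rewrite /B !mulmxA eH uA -scalemxAl uH.
have Be := symmetric_split_first Bt B0.
have /IHn[ O [d [OO DE]]] : (drsubmx B)^T = drsubmx B.
  by rewrite trmx_drsub Bt.
pose P : 'M[R]_(1 + n) := block_mx 1%:M 0 0 O.
have PP : P *m P^T = 1%:M.
  rewrite /P tr_block_mx !trmx0 trmx1 mulmx_block OO !mul0mx !mulmx0 mulmx1.
  by rewrite !addr0 add0r -scalar_mx_block.
exists (P *m H), (row_mx a%:M d : 'rV_(1 + n)); split.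
  by rewrite trmx_mul Ht mulmxA -(mulmxA P) HH mulmx1.
rewrite trmx_mul Ht.
set D := diag_mx _.
have -> : H *m P^T *m D *m (P *m H) = H *m (P^T *m D *m P) *m H.
  by rewrite !mulmxA.
rewrite /D {D}.
have -> : P^T *m diag_mx (row_mx a%:M d) *m P = B.
  rewrite Be DE /P tr_block_mx !trmx0 trmx1.
  have -> : diag_mx (row_mx a%:M d : 'rV_(1 + n)) = block_mx a%:M 0 0 (diag_mx d).
    by rewrite diag_mx_row; congr block_mx; apply/matrixP => i j;
      rewrite !ord1 !mxE eqxx.
  by rewrite !mulmx_block !mul0mx !mulmx0 ?mul1mx ?mulmx1 ?addr0 ?add0r !mul0mx.
by rewrite /B -!mulmxA HH mulmx1 !mulmxA HH mul1mx.
Qed.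

End Spectral.

(** * Law of inertia *)

Section Inertia.
Variables (R : realType) (n : nat).
Local Notation M := 'M[R]_n.
Implicit Types (A B C O Q : M) (u d : 'rV[R]_n) (p : nat).

Lemma char_poly_orthogonal O A : O *m O^T = 1%:M ->
  char_poly (O^T *m A *m O) = char_poly A.
Proof.
move=> /mulmx1C OO; rewrite /char_poly /char_poly_mx.
set f := map_mx polyC.
have ff : f O^T *m f O = 1%:M by rewrite /f -map_mxM OO map_mx1.
have -> : 'X%:M - f (O^T *m A *m O) = f O^T *m ('X%:M - f A) *m f O.
  rewrite mulmxBr mulmxBl /f !map_mxM; congr (_ - _).
  by rewrite scalar_mxC -mulmxA ff mulmx1.
by rewrite !det_mulmx mulrAC -det_mulmx ff det1 mul1r.
Qed.

Lemma char_poly_diag d : char_poly (diag_mx d) = \prod_i ('X - (d 0 i)%:P).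
Proof.
rewrite char_poly_trig; last exact: diag_mx_is_trig.
by apply: eq_bigr => i _; rewrite mxE eqxx.
Qed.

Definition inertia_mx p : M := diag_mx (\row_i (if (i < p)%N then 1 else -1)).

Definition qform A u : R := (u *m A *m u^T) 0 0.

Lemma qform_diag d u : qform (diag_mx d) u = \sum_i d 0 i * u 0 i ^+ 2.
Proof.
rewrite /qform mul_mx_diag mxE; apply: eq_bigr => i _.
by rewrite !mxE; ring.
Qed.

Lemma qform_congruence Q A u : qform (Q^T *m A *m Q) u = qform A (u *m Q^T).
Proof. by rewrite /qform trmx_mul trmxK !mulmxA. Qed.

Definition npos d : nat := count (fun i => 0 < d 0 i) (enum 'I_n).

(** Unique factorisation: any list of roots of the characteristic polynomial is
    a rearrangement of the diagonal d. *)
Lemma signature_spectrum O d p q : O *m O^T = 1%:M ->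
  has_signature (O^T *m diag_mx d *m O) p q <->
  npos d = p /\
  count (fun i => d 0 i < 0) (enum 'I_n) = q.
Proof.
move=> OO; rewrite /has_signature char_poly_orthogonal// char_poly_diag.
have E : \prod_i ('X - (d 0 i)%:P) =
    \prod_(a <- [seq d 0 i | i <- enum 'I_n]) ('X - a%:P).
  by rewrite big_map big_enum.
split=> [[s [sE <- <-]]|[dp dq]].
  move: sE; rewrite E => /prod_XsubC_eq/seq.permP sE.
  by split; rewrite -sE [RHS]count_map.
by exists [seq d 0 i | i <- enum 'I_n]; split; rewrite ?E 1?count_map.
Qed.

Lemma orthogonal_unit O : O *m O^T = 1%:M -> O \in unitmx.
Proof. by case/mulmx1_unit. Qed.

Lemma diag_unit d i : diag_mx d \in unitmx -> d 0 i != 0.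
Proof.
by rewrite unitmxE det_diag unitfE => /prodf_neq0; exact.
Qed.

Lemma congruence_unit A Q : Q^T *m A *m Q \in unitmx -> A \in unitmx.
Proof. by rewrite !unitmx_mul => /andP[/andP[]]. Qed.

Lemma signature_exists A : A^T = A -> A \in unitmx ->
  exists2 p, (p <= n)%N & has_signature A p (n - p).
Proof.
move=> /symmetric_spectral [ O [d [OO ->]]] /congruence_unit uD.
exists (npos d).
  by rewrite (leq_trans (count_size _ _))// size_enum_ord.
apply/signature_spectrum => //; split=> //.
have := count_predC (fun i => 0 < d 0 i) (enum 'I_n).
rewrite size_enum_ord => /(congr1 (subn^~ (npos d))).
rewrite addKn => <-; apply: eq_count => i /=.
by rewrite -leNgt lt_neqAle diag_unit.
Qed.

(** Some rearrangement of d lists its positive entries first. *)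
Lemma perm_sign_sorted d :
  exists s : {perm 'I_n}, forall i : 'I_n,
    (0 < d 0 (s i)) = (i < npos d)%N.
Proof.
pose P (i : 'I_n) := 0 < d 0 i.
pose tp := [seq i <- enum 'I_n | P i]; pose tn := [seq i <- enum 'I_n | predC P i].
have tE : perm_eq (tp ++ tn) (ord_tuple n).
  by rewrite perm_filterC val_ord_tuple perm_refl.
have [s sE] := tuple_permP tE.
have stp : size tp = npos d by rewrite size_filter.
exists s => i.
have si : s i = nth i (tp ++ tn) i.
  by rewrite sE -tnth_nth tnth_mktuple tnth_ord_tuple.
have st : size (tp ++ tn) = n by rewrite (perm_size tE) size_tuple.
rewrite si nth_cat stp; case: ltnP => [ilt|ige].
  have : nth i tp i \in tp by rewrite mem_nth ?stp.
  by rewrite mem_filter => /andP[].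
have : nth i tn (i - npos d) \in tn.
  by rewrite mem_nth// ltn_subLR// -stp -size_cat st.
by rewrite mem_filter => /andP[/negbTE].
Qed.

(** Rescaling an orthogonal diagonalisation by the square roots of |d_i| leaves
    only the signs, which a permutation sorts. *)
Lemma sylvester_normal_form A p : A^T = A -> A \in unitmx ->
  has_signature A p (n - p) ->
  exists2 Q, Q \in unitmx & A = Q^T *m inertia_mx p *m Q.
Proof.
move=> /symmetric_spectral [ O [d [OO ->]]] /congruence_unit uD.
move=> /(signature_spectrum _ _ _ OO)[<- _].
have [s sE] := perm_sign_sorted d.
pose T : M := \matrix_(i, j) (Num.sqrt `|d 0 (s i)| *+ (s i == j)).
(* T is the permutation followed by the scaling by square roots *)
have DE : diag_mx d = T^T *m inertia_mx (npos d) *m T.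
  apply/matrixP => i j; rewrite mul_mx_diag !mxE.
  rewrite (bigD1 (s^-1%g i))//= big1 => [|k ki]; last first.
    rewrite !mxE (_ : (s k == i) = false) ?mulr0n ?mul0r//; apply/negbTE.
    by apply: contra ki => /eqP <-; rewrite permK.
  rewrite !mxE permKV eqxx mulr1n addr0 -sE permKV.
  case: (i == j); last by rewrite !mulr0n mulr0.
  rewrite !mulr1n; have := diag_unit i uD; rewrite lt_def => d0.
  case: (ltrgt0P (d 0 i)) d0 => // dp _.
    by rewrite mulr1 -expr2 sqr_sqrtr ?gtr0_norm// ltW.
  by rewrite mulrN1 mulNr -expr2 sqr_sqrtr ?ltr0_norm ?opprK// oppr_ge0 ltW.
exists (T *m O); last first.
  by rewrite DE trmx_mul !mulmxA.
rewrite unitmx_mul (orthogonal_unit OO) andbT.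
by move: uD; rewrite DE unitmx_mul => /andP[].
Qed.

Lemma common_kernel_vector (N1 N2 : M) : (\rank N1 + \rank N2 < n)%N ->
  exists u : 'rV_n, [/\ u != 0, u *m N1 = 0 & u *m N2 = 0].
Proof.
move=> r12; suff : (kermx N1 :&: kermx N2)%MS != 0.
  move=> /rowV0Pn[u]; rewrite sub_capmx => /andP[/sub_kermxP u1 /sub_kermxP u2].
  by exists u.
rewrite -mxrank_eq0 -lt0n -(ltn_add2l (\rank (kermx N1 + kermx N2)%MS)) addn0.
rewrite mxrank_sum_cap (leq_ltn_trans (rank_leq_row _))// !mxrank_ker.
by have := rank_leq_row N1; have := rank_leq_row N2; lia.
Qed.

Lemma mul_pid_mx_entry (w : 'rV[R]_n) r i :
  (w *m (pid_mx r : M)) 0 i = w 0 i *+ (i < r)%N.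
Proof.
rewrite mxE (bigD1 i)//= big1 ?addr0 => [|k ki]; rewrite mxE.
  by rewrite eqxx mulr_natr.
by rewrite val_eqE (negbTE ki) mulr0.
Qed.

Lemma mul_pid_mx_eq0 (w : 'rV[R]_n) r (i : 'I_n) : w *m (pid_mx r : M) = 0 ->
  (i < r)%N -> w 0 i = 0.
Proof.
move=> /(congr1 (fun v : 'rV_n => v 0 i)); rewrite mul_pid_mx_entry mxE.
by move=> + ir; rewrite ir.
Qed.

Lemma mul_copid_mx_eq0 (w : 'rV[R]_n) r (i : 'I_n) :
  w *m (copid_mx r : M) = 0 -> (r <= i)%N -> w 0 i = 0.
Proof.
rewrite mulmxBr mulmx1 => /eqP; rewrite subr_eq0 => /eqP wE.
by rewrite leqNgt => /negbTE ri; rewrite wE mul_pid_mx_entry ri.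
Qed.

(** Law of inertia.  Let r be the number of positive eigenvalues of A, so that
    C is congruent to the normal form with r positive signs.  If r < p,
    a dimension count gives a nonzero vector in the first p coordinates, where
    C is positive, on which the normal form has no positive contribution; if
    p < r, the same happens with the signs exchanged. *)
Lemma signature_criterion A C Q p : (p <= n)%N -> A^T = A -> A \in unitmx ->
  Q \in unitmx -> A = Q^T *m C *m Q ->
  (forall u, u != 0 -> (forall i : 'I_n, (p <= i)%N -> u 0 i = 0) ->
     0 < qform C u) ->
  (forall u, u != 0 -> (forall i : 'I_n, (i < p)%N -> u 0 i = 0) ->
     qform C u < 0) ->
  has_signature A p (n - p).
Proof.
move=> pn As uA uQ AE Cpos Cneg.
have [r rn Ar] := signature_exists As uA.
have [Q' uQ' AE'] := sylvester_normal_form As uA Ar.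
pose P := Q' *m invmx Q.
have CE : C = P^T *m inertia_mx r *m P.
  rewrite /P trmx_mul !mulmxA -(mulmxA _ _ (inertia_mx r)) -(mulmxA (invmx Q)^T).
  rewrite -AE' AE -!mulmxA mulmxV// mulmx1 !mulmxA -trmx_mul mulmxV// trmx1.
  by rewrite mul1mx.
suff -> : p = r by [].
apply/eqP; rewrite eqn_leq; apply/andP; split; rewrite leqNgt; apply/negP => lt.
- have [|u [u0 /mul_copid_mx_eq0 u1]] :=
    @common_kernel_vector (copid_mx p) (P^T *m pid_mx r).
    rewrite rank_copid_mx//; apply: (@leq_ltn_trans (n - p + r)%N); last by lia.
    by rewrite leq_add2l (leq_trans (mxrankM_maxr _ _))// rank_pid_mx.
  rewrite mulmxA => /mul_pid_mx_eq0 u2.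
  have := Cpos u u0 u1; rewrite CE qform_congruence; apply/negP; rewrite -leNgt.
  rewrite qform_diag; apply: sumr_le0 => i _; rewrite mxE; case: ltnP => ir.
    by rewrite u2// expr0n mulr0.
  by rewrite mulN1r oppr_le0 sqr_ge0.
- have [|u [u0 /mul_pid_mx_eq0 u1]] :=
    @common_kernel_vector (pid_mx p) (P^T *m copid_mx r).
    rewrite rank_pid_mx//; apply: (@leq_ltn_trans (p + (n - r))%N); last by lia.
    by rewrite leq_add2l (leq_trans (mxrankM_maxr _ _))// rank_copid_mx.
  rewrite mulmxA => /mul_copid_mx_eq0 u2.
  have := Cneg u u0 u1; rewrite CE qform_congruence; apply/negP; rewrite -leNgt.
  rewrite qform_diag; apply: sumr_ge0 => i _; rewrite mxE; case: ltnP => ir.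
    by rewrite mul1r sqr_ge0.
  by rewrite u2// expr0n mulr0.
Qed.

Lemma qform_inertia_pos p u : (forall i : 'I_n, (p <= i)%N -> u 0 i = 0) ->
  qform (inertia_mx p) u = sqnorm u.
Proof.
move=> up; rewrite qform_diag; apply: eq_bigr => i _; rewrite mxE.
by case: ltnP => ip; rewrite ?mul1r// up// expr0n mulr0.
Qed.

Lemma qform_inertia_neg p u : (forall i : 'I_n, (i < p)%N -> u 0 i = 0) ->
  qform (inertia_mx p) u = - sqnorm u.
Proof.
move=> up; rewrite qform_diag -sumrN; apply: eq_bigr => i _; rewrite mxE.
by case: ltnP => ip; rewrite ?mulN1r// up// expr0n mulr0 oppr0.
Qed.

(** From |u_i u_j| <= (u_i^2 + u_j^2) / 2. *)
Lemma qform_bound C u (e : R) : (forall i j, `|C i j| <= e) ->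
  `|qform C u| <= e * n%:R * sqnorm u.
Proof.
move=> Ce; have qE : qform C u = \sum_j \sum_i C i j * (u 0 i * u 0 j).
  rewrite /qform mxE; apply: eq_bigr => j _; rewrite !mxE mulr_suml.
  by apply: eq_bigr => i _; ring.
rewrite qE (le_trans (ler_norm_sum _ _ _))//.
apply: (@le_trans _ _ (\sum_j \sum_i e * ((u 0 i ^+ 2 + u 0 j ^+ 2) / 2))).
  apply: ler_sum => j _; rewrite (le_trans (ler_norm_sum _ _ _))//.
  apply: ler_sum => i _; rewrite normrM ler_pM// ler_norml.
  have := sqr_ge0 (u 0 i + u 0 j); have := sqr_ge0 (u 0 i - u 0 j).
  by move=> h1 h2; apply/andP; split; nra.
rewrite le_eqVlt; apply/orP; left; apply/eqP.
have -> : \sum_j \sum_i e * ((u 0 i ^+ 2 + u 0 j ^+ 2) / 2) =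
    \sum_(j < n) (e / 2 * sqnorm u + e / 2 * n%:R * u 0 j ^+ 2).
  apply: eq_bigr => j _; rewrite mulr_sumr -mulrA mulr_natl.
  rewrite -[X in _ * (_ *+ X)]card_ord -sumr_const mulr_sumr -big_split /=.
  by apply: eq_bigr => i _; ring.
rewrite big_split /= sumr_const card_ord -mulr_sumr -/(sqnorm u) -mulr_natl.
by field.
Qed.

(** Entries of size at most 1 / (n + 1) perturb the form by less than |u|^2,
    which is the absolute value of the unperturbed form on each of the two
    coordinate subspaces. *)
Lemma near_inertia_signature A C Q p : (p <= n)%N -> A^T = A -> A \in unitmx ->
  Q \in unitmx -> A = Q^T *m C *m Q ->
  (forall i j, `|(C - inertia_mx p) i j| <= (n.+1)%:R^-1) ->
  has_signature A p (n - p).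
Proof.
move=> pn As uA uQ AE near; set D := C - inertia_mx p in near.
have CE u : qform C u = qform (inertia_mx p) u + qform D u.
  rewrite -[C in LHS](subrK (inertia_mx p)) -/D addrC.
  by rewrite /qform mulmxDr mulmxDl mxE.
have small u : u != 0 -> `|qform D u| < sqnorm u.
  move=> u0; apply: le_lt_trans (qform_bound u near) _.
  rewrite -[ltRHS]mul1r ltr_pM2r ?sqnorm_gt0// mulrC ltr_pdivrMr ?ltr0n//.
  by rewrite mul1r ltr_nat.
apply: (signature_criterion pn As uA uQ AE) => u u0 up; have := small u u0;
  rewrite CE ltr_norml => /andP[].
- by rewrite qform_inertia_pos//; lra.
- by rewrite qform_inertia_neg//; lra.
Qed.

Lemma GLSym_congruence A P p : (p <= n)%N -> GLSym R n p A -> P \in unitmx ->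
  GLSym R n p (P^T *m A *m P).
Proof.
move=> pn [/SymP As uA Ap] uP.
have Bs : (P^T *m A *m P)^T = P^T *m A *m P by rewrite !trmx_mul trmxK As mulmxA.
have uB : P^T *m A *m P \in unitmx by rewrite !unitmx_mul unitmx_tr uP uA.
split=> //; first exact/SymP.
have [Q uQ AE] := sylvester_normal_form As uA Ap.
apply: (@near_inertia_signature _ (inertia_mx p) (Q *m P)) => //.
- by rewrite unitmx_mul uQ.
- by rewrite AE trmx_mul !mulmxA.
- by move=> i j; rewrite subrr mxE normr0 invr_ge0 ler0n.
Qed.

End Inertia.

(** * Matrix exponential *)

Section MatrixExponential.
Variables (R : realType) (n : nat).
Local Notation M := 'M[R]_n.

Lemma cvg_mx_entries (T : Type) (F : set_system T) (FF : Filter F)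
    (f : T -> M) (l : M) :
  (forall i j, (f t i j : R^o) @[t --> F] --> (l i j : R^o)) -> f @ F --> l.
Proof.
move=> fl; rewrite [l]matrix_sum_delta.
have -> : f = fun t => \sum_i \sum_j f t i j *: delta_mx i j.
  by apply/funext => t; rewrite -matrix_sum_delta.
apply: cvg_big => [|i _]; first exact: add_continuous.
apply: cvg_big => [|j _]; first exact: add_continuous.
by apply: cvgZr_tmp; exact: fl.
Qed.

Lemma is_derive_entries (f : R -> M) (df : M) (t : R) :
  (forall i j, is_derive t (1 : R) (fun s => f s i j : R^o) (df i j)) ->
  is_derive t (1 : R) f df.
Proof.
move=> H; have d : derivable f t 1.
  by apply/derivable_mxP => i j; case: (H i j).
apply: DeriveDef => //; rewrite derive_mx//; apply/matrixP => i j.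
by rewrite mxE; have h := H i j; exact: (is_deriveE h).
Qed.

Lemma mulr_mulmx (A B : M) : A * B = A *m B.
Proof. by []. Qed.

(** The norm is the largest entry, so each product costs a factor n |C|. *)
Lemma expr_entry_bound (C : M) k i j :
  `|(C ^+ k) i j| <= (n%:R * `|C|) ^+ k.
Proof.
elim: k i j => [|k IHk] i j.
  by rewrite !expr0 /GRing.one /= mxE; case: (_ == _); rewrite ?normr1 ?normr0.
rewrite exprSr mulr_mulmx mxE (le_trans (ler_norm_sum _ _ _))//.
apply: (@le_trans _ _ (\sum_(l < n) (n%:R * `|C|) ^+ k * `|C|)).
  apply: ler_sum => l _; rewrite normrM ler_pM//.
  rewrite [leRHS]/Num.Def.normr /= mx_normrE.
  exact: (le_bigmax _ (fun ij : 'I_n * 'I_n => `|C ij.1 ij.2|) (l, j)).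
by rewrite sumr_const card_ord exprSr -[leLHS]mulr_natl mulrCA.
Qed.

Lemma cvg_eq_limits (u v : nat -> M) (a b : M) :
  (forall N, u N = v N) -> u @ \oo --> a -> v @ \oo --> b -> a = b.
Proof.
move=> /funext -> va vb; exact: (cvg_unique (@norm_hausdorff R M) va vb).
Qed.

(** Coefficients of the power series in t of the (i, j) entry of e^(tC) C^m;
    the exponent m counts derivatives. *)
Definition exp_entry_coeff (C : M) m i j (k : nat) : R :=
  (C ^+ (k + m)) i j / k`!%:R.

Lemma cvg_exp_entry C m i j (x : R) :
  cvgn (pseries (exp_entry_coeff C m i j) x).
Proof.
apply: normed_cvg; set c := n%:R * `|C|.
apply: (@series_le_cvg _ _ (fun k => c ^+ m * exp_coeff (c * `|x|) k)).
- by move=> k; rewrite normr_ge0.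
- move=> k; apply: mulr_ge0; first by rewrite exprn_ge0 ?mulr_ge0.
  by apply: exp_coeff_ge0; rewrite !mulr_ge0.
- move=> k; rewrite /exp_entry_coeff /exp_coeff /= !normrM normfV normrX.
  rewrite normr_nat.
  have -> (d y e : R) : d ^+ m * ((d * y) ^+ k * e) = d ^+ (k + m) * e * y ^+ k.
    by rewrite exprD exprMn; ring.
  by rewrite !ler_wpM2r ?invr_ge0 ?exprn_ge0//; exact: expr_entry_bound.
- apply: is_cvg_seriesZ; exact: is_cvg_series_exp_coeff.
Qed.

Lemma pseries_diffs_exp_entry C m i j :
  pseries_diffs (exp_entry_coeff C m i j) = exp_entry_coeff C m.+1 i j.
Proof.
apply/funext => k; rewrite /pseries_diffs /exp_entry_coeff addSnnS factS natrM.
rewrite invfM mulrCA; congr (_ * _).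
by rewrite mulrA mulfV ?mul1r// pnatr_eq0.
Qed.

Lemma scalemx_expr (x : R) (C : M) k : (x *: C) ^+ k = x ^+ k *: C ^+ k.
Proof.
elim: k => [|k IHk]; first by rewrite !expr0 scale1r.
rewrite !exprS IHk.
rewrite -[LHS]/((x *: C) *m (x ^+ k *: (C ^+ k : M))).
rewrite mulr_mulmx.
by rewrite -scalemxAl -scalemxAr scalerA.
Qed.

Lemma series_exp_entry (C : M) m i j (x : R) N :
  pseries (exp_entry_coeff C m i j) x N =
  (series (fun k => (k`!%:R)^-1 *: (x *: C) ^+ k) N *m C ^+ m) i j.
Proof.
rewrite /pseries /series /= mulmx_suml summxE; apply: eq_bigr => k _.
rewrite scalemx_expr scalerA -scalemxAl -mulr_mulmx.
by rewrite -exprD mxE /exp_entry_coeff mulrC [_ * x ^+ k]mulrC mulrA mulrAC.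
Qed.

Lemma cvg_expmx (A : M) :
  series (fun k => (k`!%:R)^-1 *: A ^+ k) @ \oo --> expmx A.
Proof.
apply/cvg_ex; exists (\matrix_(i, j) limn (pseries (exp_entry_coeff A 0 i j) 1)).
apply: cvg_mx_entries => i j; rewrite mxE.
have -> : (fun N => (series (fun k => (k`!%:R)^-1 *: A ^+ k) N) i j) =
    pseries (exp_entry_coeff A 0 i j) 1.
  by apply/funext => N; rewrite series_exp_entry scale1r expr0 mulmx1.
exact: cvg_exp_entry.
Qed.

Lemma expmx_entry (C : M) m i j (x : R) :
  (expmx (x *: C) *m C ^+ m) i j = limn (pseries (exp_entry_coeff C m i j) x).
Proof.
apply/esym/cvg_lim => //.
have -> : pseries (exp_entry_coeff C m i j) x = fun N =>
  entry i j (series (fun k => (k`!%:R)^-1 *: (x *: C) ^+ k) N *m C ^+ m).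
  by apply/funext => N; rewrite series_exp_entry.
have H := cvg_linear_mx (L := mulmxr (C ^+ m : M)) (@cvg_expmx (x *: C)).
exact: (cvg_linear_mx (L := entry i j) H).
Qed.

(** Termwise differentiation of the power series of each entry, which raises
    the exponent m in [exp_entry_coeff] by one. *)
Lemma is_derive_expmx (C : M) (t : R) :
  is_derive t (1 : R) (fun s : R => expmx (s *: C)) (expmx (t *: C) *m C).
Proof.
apply: is_derive_entries => i j.
have -> : (fun s : R => expmx (s *: C) i j : R^o) =
    fun s => limn (pseries (exp_entry_coeff C 0 i j) s).
  by apply/funext => s; rewrite -expmx_entry expr0 mulmx1.
rewrite -[X in _ *m X]expr1 expmx_entry -pseries_diffs_exp_entry.
apply: (@pseries_snd_diffs _ _ (`|t| + 1));
  rewrite ?pseries_diffs_exp_entry; try exact: cvg_exp_entry.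
by rewrite [ltRHS]ger0_norm ?addr_ge0// ltrDl.
Qed.

(** The relation passes to powers, then to the limit of the series.  It covers
    both the commutation of C with its exponential and the passage of K C
    symmetric to K e^C = (e^C)^T K. *)
Lemma expmx_intertwine (A B K : M) : K *m A = B *m K ->
  K *m expmx A = expmx B *m K.
Proof.
move=> KAB; have KX k : K *m A ^+ k = B ^+ k *m K.
  elim: k => [|k IHk]; first by rewrite !expr0 mulmx1 mul1mx.
  rewrite exprSr mulr_mulmx mulmxA IHk -mulmxA KAB mulmxA.
  by rewrite exprSr.
have l1 := cvg_linear_mx (L := mulmx K) (@cvg_expmx A).
have l2 := cvg_linear_mx (L := mulmxr K) (@cvg_expmx B).
apply: (cvg_eq_limits _ l1 l2) => N.
rewrite /= /series /= mulmx_suml mulmx_sumr; apply: eq_bigr => k _.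
by rewrite -scalemxAl -scalemxAr KX.
Qed.

Lemma trmx_expmx (A : M) : (expmx A)^T = expmx A^T.
Proof.
have TX k : (A ^+ k)^T = A^T ^+ k.
  elim: k => [|k IHk]; first by rewrite !expr0 trmx1.
  by rewrite exprSr mulr_mulmx trmx_mul IHk exprS.
have l1 := cvg_linear_mx (L := @trmx R n n) (@cvg_expmx A).
apply: (cvg_eq_limits _ l1 (@cvg_expmx A^T)) => N.
rewrite /= /series /= linear_sum; apply: eq_bigr => k _.
by rewrite linearZ /= TX.
Qed.

Lemma expmx0 : expmx (0 : M) = 1%:M.
Proof.
have l := @cvg_expmx 0; rewrite -cvg_shiftS in l.
have l1 : (fun=> 1%:M : M) @ \oo --> (1%:M : M) by exact: cvg_cst.
apply: (cvg_eq_limits _ l l1) => N.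
rewrite /= /series /= big_nat_recl//= expr0 fact0 invr1 scale1r big1 ?addr0//.
by move=> k _; rewrite expr0n /= scaler0.
Qed.

End MatrixExponential.

(** * Linear differential equations with constant coefficients *)

Section LinearODE.
Variables (R : realType) (n : nat).
Local Notation M := 'M[R]_n.
Implicit Types (C K : M) (F : R -> M) (J : set R) (t : R).

Lemma constant_on_interval J F : is_interval J ->
  (forall t, J t -> is_derive t (1 : R) F 0) ->
  forall s t, J s -> J t -> F s = F t.
Proof.
move=> JI dF s t Js Jt; wlog st : s t Js Jt / s <= t.
  by move=> H; case: (leP s t) => [/H|/ltW/H ->]//; exact.
apply/matrixP => i j; pose f (x : R) : R := F x i j.
have df x : x \in `[s, t] -> is_derive x (1 : R) (f : R -> R^o) 0.
  rewrite in_itv /= => xst.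
  have := @is_derive_linear _ _ _ _ (entry i j) _ _ _ _
    (@linear_mx_continuous _ _ _ _ _) (dF x (JI _ _ Js Jt _ xst)).
  by rewrite linear0.
have c : {within `[s, t], continuous f}.
  apply: (@derivable_within_continuous R R^o f) => x xst.
  by case: (df x xst).
have df' x : x \in `]s, t[ -> is_derive x (1 : R) (f : R -> R^o) 0.
  by move=> /subset_itv_oo_cc; exact: df.
have [x _] := @MVT_segment R f (fun=> 0) s t st df' c.
by rewrite mul0r => /eqP; rewrite subr_eq0 => /eqP E; exact: esym E.
Qed.

Lemma expmx_comm C t : C *m expmx (t *: C) = expmx (t *: C) *m C.
Proof. by apply: expmx_intertwine; rewrite -scalemxAl -scalemxAr. Qed.

Lemma is_derive_expmxN C t :
  is_derive t (1 : R) (fun s : R => expmx (s *: - C))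
    (- (C *m expmx (t *: - C))).
Proof.
apply: (is_derive_eq (is_derive_expmx (- C) t)).
by rewrite -expmx_comm mulNmx.
Qed.

Lemma constant_mul_expmxN J F C : is_interval J ->
  (forall t, J t -> is_derive t (1 : R) F (F t *m C)) ->
  forall s t, J s -> J t ->
    F s *m expmx (s *: - C) = F t *m expmx (t *: - C).
Proof.
move=> JI dF; apply: constant_on_interval => // t Jt.
apply: (is_derive_eq (is_derive_mulmx (dF t Jt) (is_derive_expmxN C t))).
by rewrite mulmxN mulmxA subrr.
Qed.

Lemma expmx_mulN C t : expmx (t *: C) *m expmx (t *: - C) = 1%:M.
Proof.
rewrite (@constant_mul_expmxN setT (fun s => expmx (s *: C)) C _ _ t 0)//.
  by rewrite !scale0r expmx0 mulmx1.
by move=> s _; exact: is_derive_expmx.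
Qed.

Lemma expmx_unit C t : expmx (t *: C) \in unitmx.
Proof. by case/mulmx1_unit : (expmx_mulN C t). Qed.

Lemma linear_ode_solution J F C : is_interval J ->
  (forall t, J t -> is_derive t (1 : R) F (F t *m C)) ->
  forall s t, J s -> J t ->
    F t = F s *m expmx (s *: - C) *m expmx (t *: C).
Proof.
move=> JI dF s t Js Jt; rewrite (constant_mul_expmxN JI dF Js Jt) -mulmxA.
by have := expmx_mulN (- C) t; rewrite opprK => ->; rewrite mulmx1.
Qed.

(** Both sides solve F' = F C with the same value at 0. *)
Lemma expmx_half C t :
  expmx (t *: C) = expmx (t *: (2^-1 *: C)) *m expmx (t *: (2^-1 *: C)).
Proof.
set H := 2^-1 *: C.
rewrite (@linear_ode_solution setT (fun s => expmx (s *: H) *m expmx (s *: H)) C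
  _ _ 0 t)//; first by rewrite !scale0r expmx0 !mul1mx.
move=> s _; apply: (is_derive_eq (is_derive_mulmx (is_derive_expmx H s)
  (is_derive_expmx H s))).
have -> : expmx (s *: H) *m H *m expmx (s *: H) =
    expmx (s *: H) *m expmx (s *: H) *m H.
  by rewrite -!mulmxA expmx_comm.
rewrite -!mulmxA -!mulmxDr; congr (_ *m (_ *m _)).
exact: half_scale_add.
Qed.

(** That K C is symmetric means K C = C^T K, so one of the two factors of
    [expmx_half] can cross K, becoming its transpose. *)
Lemma expmx_congruence K C t : K^T = K -> (K *m C)^T = K *m C ->
  K *m expmx (t *: C) =
  (expmx (t *: (2^-1 *: C)))^T *m K *m expmx (t *: (2^-1 *: C)).
Proof.
move=> Ks KCs; rewrite {1}expmx_half mulmxA; congr (_ *m _).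
rewrite trmx_expmx; apply: expmx_intertwine.
rewrite !linearZ /= -?scalemxAr -!scalemxAl; congr (_ *: (_ *: _)).
by rewrite -KCs trmx_mul Ks.
Qed.

End LinearODE.

(** * Submanifolds of matrices and index of a form twisted by an involution *)

Section Submanifolds.
Variables (R : realType) (n : nat).
Local Notation M := 'M[R]_n.

Lemma GL_submanifold : submanifold (GL R n) fullv.
Proof.
exists (GL R n); split; first exact: open_GL.
by apply/seteqP; split=> [A uA|A []]//; split=> //=; rewrite memvf.
Qed.

(** In the coordinates where A is the normal form, matrices close to A have
    entries close to those of the normal form. *)
Lemma GLSym_near p (A : M) : (p <= n)%N -> GLSym R n p A ->
  \forall B \near A, B \in Sym R n -> GLSym R n p B.
Proof.
move=> pn [/SymP As uA Ap]; have [Q uQ AE] := sylvester_normal_form As uA Ap.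
pose L (B : M) := (invmx Q)^T *m B *m invmx Q.
have QL B : B = Q^T *m L B *m Q.
  rewrite /L !mulmxA -trmx_mul mulVmx// trmx1 mul1mx -mulmxA mulVmx//.
  by rewrite mulmx1.
have LA : L A = inertia_mx R n p.
  rewrite /L AE !mulmxA -trmx_mul mulmxV// trmx1 mul1mx -mulmxA mulmxV//.
  by rewrite mulmx1.
have Lc : L B @[B --> A] --> L A.
  exact: (cvg_linear_mx (L := mulmxr (invmx Q))
           (cvg_linear_mx (L := mulmx (invmx Q)^T) (@cvg_id _ _))).
have c0 : (0 : R) < n.+1%:R^-1 by rewrite invr_gt0 ltr0n.
have near1 : \forall B \near A, `|L A - L B| <= n.+1%:R^-1.
  by move/cvgrPdist_le : Lc; exact.
have near2 : \forall B \near A, GL R n B.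
  by apply: open_nbhs_nbhs; split => //; exact: open_GL.
apply: filterS2 near1 near2 => B nB uB SB.
split=> //; apply: (near_inertia_signature pn _ uB uQ (QL B)); first exact/SymP.
move=> i j; apply: le_trans nB; rewrite -LA -normrN opprB.
rewrite [leRHS]/Num.Def.normr /= mx_normrE.
apply: (@le_trans _ _ `|(L B - L A) i j|); first by rewrite -opprB mxE normrN.
exact: (le_bigmax _ (fun ij : 'I_n * 'I_n => `|(L B - L A) ij.1 ij.2|) (i, j)).
Qed.

Lemma GLSym_submanifold p : (p <= n)%N -> submanifold (GLSym R n p) (Sym R n).
Proof.
(* the largest open set of matrices whose symmetric elements are in GLSym *)
move=> pn; exists ([set B | B \in Sym R n -> GLSym R n p B]^°).
split; first exact: open_interior.
apply/seteqP; split=> [A AS|A [/interior_subset H SA]]; last exact: H.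
by split; [exact: GLSym_near|case: AS].
Qed.

Lemma GLSym_sub_GL p : GLSym R n p `<=` GL R n.
Proof. by move=> A []. Qed.

Lemma trmx_invmx (A : M) : A^T = A -> (invmx A)^T = invmx A.
Proof. by move=> As; rewrite trmx_inv As. Qed.

Lemma Sym_jordan p (A u v : M) : GLSym R n p A -> u \in Sym R n ->
  v \in Sym R n -> u *m invmx A *m v + v *m invmx A *m u \in Sym R n.
Proof.
move=> [/SymP As _ _] /SymP us /SymP vs; apply/SymP.
by rewrite linearD /= !trmx_mul us vs trmx_invmx// !mulmxA addrC.
Qed.

Lemma frobenius (A : M) : \tr (A^T *m A) = \sum_i \sum_j A j i ^+ 2.
Proof.
by apply: eq_bigr => i _; rewrite mxE; apply: eq_bigr => j _; rewrite mxE expr2.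
Qed.

Lemma frobenius_ge0 (A : M) : 0 <= \tr (A^T *m A).
Proof. by rewrite frobenius; do 2!apply: sumr_ge0 => ? _; exact: sqr_ge0. Qed.

Lemma frobenius_eq0 (A : M) : \tr (A^T *m A) = 0 -> A = 0.
Proof.
rewrite frobenius => /eqP; rewrite psumr_eq0 => [/allP H|i _]; last first.
  by apply: sumr_ge0 => j _; exact: sqr_ge0.
apply/matrixP => i j; rewrite mxE; apply/eqP.
have /= := H j (mem_index_enum _); rewrite psumr_eq0 => [/allP H'|k _]; last first.
  exact: sqr_ge0.
by have := H' i (mem_index_enum _); rewrite /= sqrf_eq0.
Qed.

(** Up to the isomorphism phi, the form at x is <theta B, B> for the Frobenius
    product and an involution theta.  It is negative definite on
    the (-1)-eigenspace and nonnegative on the (+1)-eigenspace, and these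
    span.  A negative definite subspace meets the latter trivially, so its
    dimension is at most that of the former. *)
Lemma index_involution (S S0 : {vspace M}) (g : M -> M -> M -> R) (x : M)
    (phi theta : 'End(M)) :
  (S0 :&: lker phi = 0)%VS -> (phi @: S0)%VS = S ->
  (forall B, B \in S0 -> theta B \in S0) ->
  (forall B, B \in S0 -> theta (theta B) = B) ->
  (forall B, B \in S0 -> g x (phi B) (phi B) = \tr ((theta B)^T *m B)) ->
  index_at S g x (\dim (S0 :&: lker (theta + \1%VF)%R)%VS).
Proof.
move=> phi0 phiS thS thK gE.
set N0 := (S0 :&: lker (theta + \1%VF)%R)%VS.
pose P0 := (S0 :&: lker (theta - \1%VF)%R)%VS.
have thN B : B \in N0 -> B \in S0 /\ theta B = - B.
  rewrite memv_cap memv_ker add_lfunE id_lfunE addr_eq0 => /andP[SB /eqP tB].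
  by [].
have thP B : B \in P0 -> B \in S0 /\ theta B = B.
  rewrite memv_cap memv_ker add_lfunE opp_lfunE id_lfunE subr_eq0.
  by move=> /andP[SB /eqP tB].
have dimphi (T : {vspace M}) : (T <= S0)%VS -> \dim (phi @: T) = \dim T.
  move=> TS; apply: limg_dim_eq; apply/eqP; rewrite -subv0 -phi0.
  exact: capvS.
have N0S : (N0 <= S0)%VS by exact: capvSl.
have P0S : (P0 <= S0)%VS by exact: capvSl.
have split0 : (S0 <= N0 + P0)%VS.
  apply/subvP => B SB.
  have -> : B = 2^-1 *: (B - theta B) + 2^-1 *: (B + theta B).
    by rewrite -scalerDr addrACA addNr addr0 scalerDr half_scale_add.
  apply: memv_add; rewrite memv_cap.
    rewrite rpredZ ?rpredB ?thS//= memv_ker add_lfunE id_lfunE linearZ /= linearB /=.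
    by rewrite thK// -scalerDr addrC subrKA subrr scaler0.
  rewrite rpredZ ?rpredD ?thS//= memv_ker add_lfunE opp_lfunE id_lfunE linearZ /=.
  by rewrite linearD /= thK// -scalerBr [theta B + B]addrC subrr scaler0.
split.
  exists (phi @: N0)%VS; split; [by rewrite -phiS limgS | | exact: dimphi].
  move=> _ /memv_imgP[B /thN[SB tB] ->] pB; rewrite gE// tB.
  rewrite linearN /= mulNmx mxtraceN oppr_lt0 lt_def frobenius_ge0 andbT.
  by apply: contra pB => /eqP/frobenius_eq0 ->; rewrite linear0.
move=> V VS Vneg.
have VP : (V :&: phi @: P0 = 0)%VS.
  apply/eqP; rewrite -subv0; apply/subvP => v; rewrite memv_cap memv0.
  move=> /andP[Vv /memv_imgP[B /thP[SB tB] vE]]; apply/eqP; apply/eqP.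
  apply: contraT => v0; have := Vneg v Vv v0.
  by rewrite vE gE// tB ltNge frobenius_ge0.
have : (\dim (V + phi @: P0) <= \dim S)%N.
  by apply: dimvS; rewrite subv_add VS -phiS limgS.
rewrite dimv_disjoint_sum// dimphi// -phiS dimphi// => VPS.
have := leq_trans (dimvS split0) (dimv_add_leqif N0 P0).1.
move=> /(leq_trans VPS); by rewrite leq_add2r.
Qed.

End Submanifolds.

(** * The trace metric is semi-Riemannian *)

Section TraceMetric.
Variables (R : realType) (n : nat).
Local Notation M := 'M[R]_n.
Local Notation g := (@trace_metric R n).

Lemma trace_metric_linear (x u v w : M) (a : R) :
  g x (a *: u + v) w = a * g x u w + g x v w.
Proof.
rewrite /trace_metric mulmxDr !mulmxDl mxtraceD.
by rewrite -scalemxAr -!scalemxAl mxtraceZ.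
Qed.

Lemma trace_metric_sym (x v w : M) : g x v w = g x w v.
Proof. by rewrite /trace_metric -[_ *m invmx x *m w]mulmxA mxtrace_mulC !mulmxA. Qed.

Lemma trace_metric_smooth U S (v w : M) : submanifold U S -> U `<=` GL R n ->
  smooth U S ((fun x => g x v w) : M -> R^o).
Proof.
move=> US UGL k; have I k' := Ck_invmx US UGL k'.
apply: (@Ck_linear_mx R n U S US R^o (@mxtrace R n)).
by repeat (apply: Ck_mulmx => //); exact: Ck_cst.
Qed.

(** Against this vector, the metric is the squared Frobenius norm of
    x^-1 v x^-1. *)
Lemma trace_metric_nondegenerate (x v : M) : x \in unitmx ->
  g x v (invmx x *m v *m invmx x)^T = 0 -> v = 0.
Proof.
move=> ux; rewrite /trace_metric mxtrace_mulC => /frobenius_eq0 H.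
rewrite -(mul0mx _ x) -(mulmx0 _ x) -H !mulmxA mulmxV// mul1mx -mulmxA mulVmx//.
by rewrite mulmx1.
Qed.

Lemma GL_semi_riemannian : semi_riemannian_metric (GL R n) fullv g.
Proof.
split.
- by move=> x _ a u v w _ _ _; exact: trace_metric_linear.
- by move=> x _ v w _ _; exact: trace_metric_sym.
- move=> x ux v _ H; apply: (trace_metric_nondegenerate ux).
  by apply: H; rewrite memvf.
- move=> v w _ _; apply: trace_metric_smooth => //; exact: GL_submanifold.
- eexists => x ux; apply: (@index_involution _ _ _ fullv _ _
    (linfun (mulmx x)) (linfun (@trmx R n n))).
  + apply/eqP; rewrite -subv0; apply/subvP => B; rewrite memv_cap memv_ker.
    rewrite lfunE memv0 /= => /andP[_ /eqP xB].
    by rewrite -(mulKmx ux B) xB mulmx0.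
  + apply/eqP; rewrite eqEsubv subvf; apply/subvP => B _; apply/memv_imgP.
    by exists (invmx x *m B); rewrite ?memvf// lfunE /= mulKVmx.
  + by move=> B _; rewrite memvf.
  + by move=> B _; rewrite !lfunE /= trmxK.
  + by move=> B _; rewrite !lfunE /= trmxK /trace_metric mulKmx// -mulmxA mulKmx.
Qed.

Lemma inertia_mx_sqr p : inertia_mx R n p *m inertia_mx R n p = 1%:M.
Proof.
rewrite mulmx_diag; apply/matrixP => i j; rewrite !mxE.
by case: ifP => _; rewrite ?mulr1 ?mulrNN ?mulr1.
Qed.

Lemma inertia_mx_tr p : (inertia_mx R n p)^T = inertia_mx R n p.
Proof. exact: tr_diag_mx. Qed.

Lemma GLSym_semi_riemannian p : (p <= n)%N ->
  semi_riemannian_metric (GLSym R n p) (Sym R n) g.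
Proof.
move=> pn; split.
- by move=> x _ a u v w _ _ _; exact: trace_metric_linear.
- by move=> x _ v w _ _; exact: trace_metric_sym.
- move=> x [/SymP xs ux _] v /SymP vs H; apply: (trace_metric_nondegenerate ux).
  apply: H; apply/SymP; rewrite trmxK !trmx_mul vs trmx_invmx//.
  by rewrite mulmxA.
- move=> v w _ _; apply: trace_metric_smooth; first exact: GLSym_submanifold.
  exact: GLSym_sub_GL.
set E := inertia_mx R n p.
have EE : E *m E = 1%:M by exact: inertia_mx_sqr.
have Et : E^T = E by exact: inertia_mx_tr.
eexists => x [/SymP xs ux xp].
have [Q uQ xE] := sylvester_normal_form xs ux xp; rewrite -/E in xE.
(* so that, at v = Q^T B Q, the metric is tr (E B E B) *)
have xQ : invmx x *m Q^T = invmx Q *m E.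
  have <- : x *m (invmx Q *m E) = Q^T.
    by rewrite xE -!mulmxA mulKVmx// EE mulmx1.
  by rewrite mulKmx.
have uQt : Q^T \in unitmx by rewrite unitmx_tr.
apply: (@index_involution _ _ _ (Sym R n) _ _
   (linfun (mulmxr Q \o mulmx Q^T)) (linfun (mulmxr E \o mulmx E))).
- apply/eqP; rewrite -subv0; apply/subvP => B; rewrite memv_cap => /andP[_].
  rewrite memv_ker lfunE memv0 /= => /eqP xB.
  by rewrite -(mulKmx uQt B) -(mulmxK uQ (Q^T *m B)) xB mul0mx mulmx0.
- apply/eqP; rewrite eqEsubv; apply/andP; split; apply/subvP => B.
    move=> /memv_imgP[C /SymP Cs ->]; rewrite lfunE /=; apply/SymP.
    by rewrite !trmx_mul trmxK Cs mulmxA.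
  move=> /SymP Bs; apply/memv_imgP; exists (invmx Q^T *m B *m invmx Q).
    apply/SymP; rewrite !trmx_mul Bs !trmx_inv trmxK mulmxA//.
  by rewrite lfunE /= !mulmxA mulmxV// mul1mx mulmxKV.
- move=> B /SymP Bs; rewrite lfunE /=; apply/SymP.
  by rewrite !trmx_mul Bs Et mulmxA.
- by move=> B _; rewrite !lfunE /= !mulmxA EE mul1mx -mulmxA EE mulmx1.
- move=> B /SymP Bs; rewrite !lfunE /= /trace_metric.
  rewrite !mulmxA xQ -!mulmxA (mulmxA (invmx x)) xQ mxtrace_mulC.
  rewrite !mulmxA mulmxK// !trmx_mul Bs Et -!mulmxA mulKVmx//.
Qed.

End TraceMetric.

(** * Geodesics of nondegenerate symmetric matrices *)

Section Geodesics.
Variables (R : realType) (n p : nat).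
Hypothesis pn : (p <= n)%N.
Local Notation M := 'M[R]_n.
Local Notation g := (@trace_metric R n).
Local Notation U := (GLSym R n p).
Local Notation S := (Sym R n).
Implicit Types (J : set R) (c : R -> M) (K V C : M) (t : R).

Lemma derive_near_mem_Sym c t dc :
  (\forall s \near t, c s \in S) -> is_derive t (1 : R) c dc -> dc \in S.
Proof.
move=> cS dcP; apply/SymP.
have d1 := is_derive_linear (L := @trmx R n n) (@linear_mx_continuous _ _ _ _ _) dcP.
have d2 : is_derive t (1 : R) (fun s => (c s)^T) dc.
  apply: near_eq_is_derive dcP.
  by apply: filterS cS => s /SymP.
by rewrite -(is_deriveE d1) (is_deriveE d2).
Qed.

Lemma GLSym_acceleration c t : U (c t) -> derive1 c t \in S ->
  acceleration U S g c t =
  derive1n 2 c t - derive1 c t *m invmx (c t) *m derive1 c t.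
Proof.
move=> Uc Sc; rewrite /acceleration (christoffelE _ _ _ _ Uc Sc Sc)//.
- by rewrite /jordan scalerDr half_scale_add.
- exact: GLSym_submanifold.
- exact: GLSym_sub_GL.
- exact: GLSym_semi_riemannian.
- by move=> A u v; exact: Sym_jordan.
Qed.

Lemma smooth_curve_is_derive J c k t : smooth_curve J c -> J t ->
  is_derive t (1 : R) (derive1n k c) (derive1n k.+1 c t).
Proof.
by move=> cs Jt; apply: DeriveDef; [exact: cs|rewrite derive1nS derive1E].
Qed.

(** K e^(tC) is congruent to K by [expmx_congruence], so it has the same
    signature. *)
Lemma GLSym_exponential K C t : U K -> K *m C \in S ->
  U (K *m expmx (t *: C)) /\ K *m expmx (t *: C) *m C \in S.
Proof.
move=> UK /SymP KCs; have [/SymP Ks _ _] := UK.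
have UE : U (K *m expmx (t *: C)).
  rewrite expmx_congruence//; apply: GLSym_congruence => //.
  exact: expmx_unit.
split=> //; have [/SymP Es _ _] := UE; apply/SymP.
rewrite trmx_mul Es mulmxA -{1}Ks -trmx_mul KCs -!mulmxA; congr (_ *m _).
exact: expmx_comm.
Qed.

(** The geodesic equation c'' = c' c^-1 c' says that c^-1 c' has derivative zero,
    hence equals a constant C on the interval, and c' = c C is a linear
    equation. *)
Lemma geodesic_exponential J c : open_interval J -> geodesic U S g J c ->
  exists K V, [/\ U K, V \in S &
    forall t, J t -> c t = K *m expmx (t *: (invmx K *m V))].
Proof.
move=> [[t0 Jt0] oJ iJ] [cs cU cacc].
have d1 t : J t -> is_derive t (1 : R) c (derive1 c t).
  by move=> Jt; exact: (smooth_curve_is_derive 0 cs Jt).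
have d2 t : J t -> is_derive t (1 : R) (derive1 c) (derive1n 2 c t).
  by move=> Jt; exact: (smooth_curve_is_derive 1 cs Jt).
have uc t : J t -> c t \in unitmx by move=> /cU[].
have S1 t : J t -> derive1 c t \in S.
  move=> Jt; apply: derive_near_mem_Sym (d1 t Jt).
  have : \forall s \near t, J s by apply: open_nbhs_nbhs.
  by apply: filterS => s /cU[].
pose C t := invmx (c t) *m derive1 c t.
have dC t : J t -> is_derive t (1 : R) C 0.
  move=> Jt; apply: (is_derive_eq
    (is_derive_mulmx (is_derive_invmx_comp (uc t Jt) (d1 t Jt)) (d2 t Jt))).
  have := cacc t Jt; rewrite GLSym_acceleration//; [|exact: cU|exact: S1].
  move=> /eqP; rewrite subr_eq0 => /eqP ->.
  by rewrite mulNmx !mulmxA addNr.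
have CE t : J t -> C t = C t0.
  by move=> Jt; exact: (constant_on_interval iJ dC Jt Jt0).
have dcC t : J t -> is_derive t (1 : R) c (c t *m C t0).
  by move=> Jt; apply: (is_derive_eq (d1 t Jt)); rewrite -(CE t Jt) mulKVmx// uc.
have cE := linear_ode_solution iJ dcC Jt0.
have cC0 : c t0 *m C t0 = derive1 c t0 by rewrite mulKVmx// uc.
have [UK KC] : U (c t0 *m expmx (t0 *: - C t0)) /\
    c t0 *m expmx (t0 *: - C t0) *m - C t0 \in S.
  apply: GLSym_exponential; first exact: cU.
  by rewrite mulmxN cC0 rpredN S1.
(* the interval may miss 0: K is the value there of the extended curve *)
exists (c t0 *m expmx (t0 *: - C t0)), (c t0 *m expmx (t0 *: - C t0) *m C t0).
split=> //; first by rewrite mulmxN rpredN in KC.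
by move=> t Jt; rewrite (cE t Jt) mulKmx//; case: UK.
Qed.

Lemma exponential_geodesic J c K V : open J -> U K -> V \in S ->
  (forall t, J t -> c t = K *m expmx (t *: (invmx K *m V))) ->
  geodesic U S g J c.
Proof.
move=> oJ UK SV cE; pose C := invmx K *m V.
have uK : K \in unitmx by case: UK.
have KC : K *m C \in S by rewrite mulKVmx.
have near_J t : J t -> \forall s \near t, J s.
  by move=> Jt; apply: open_nbhs_nbhs.
have step k : (forall t, J t -> derive1n k c t = K *m expmx (t *: C) *m C ^+ k) ->
    forall t, J t -> is_derive t (1 : R) (derive1n k c)
      (K *m expmx (t *: C) *m C ^+ k.+1).
  move=> dk t Jt.
  have D := is_derive_mulmx (is_derive_mulmx (is_derive_cst K t (1 : R))
    (is_derive_expmx C t)) (is_derive_cst (C ^+ k : M) t (1 : R)).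
  apply: (@near_eq_is_derive _ _ _
      (fun s : R => K *m expmx (s *: C) *m (C ^+ k : M))).
    by apply: filterS (near_J t Jt) => s Js; rewrite dk.
  apply: (is_derive_eq D).
  by rewrite mul0mx add0r mulmx0 addr0 exprS mulr_mulmx !mulmxA.
have dk k t : J t -> derive1n k c t = K *m expmx (t *: C) *m C ^+ k.
  elim: k t => [|k IHk] t Jt; first by rewrite derive1n0 expr0 mulmx1 cE.
  have D := step k IHk t Jt.
  by rewrite derive1nS derive1E (is_deriveE D).
have ddk k t (Jt : J t) := step k (fun s => @dk k s) t Jt.
have dE t : J t -> derive1 c t = c t *m C.
  by move=> Jt; rewrite -derive1n1 dk// expr1 cE.
split.
- by move=> k t Jt; case: (ddk k t Jt).
- by move=> t Jt; rewrite cE//; exact: (GLSym_exponential t UK KC).1.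
- move=> t Jt; have [UE SE] := GLSym_exponential t UK KC.
  rewrite -/C -cE// in UE SE.
  rewrite GLSym_acceleration ?dE// dk// -cE//.
  have uc : c t \in unitmx by case: UE.
  by rewrite expr2 mulr_mulmx -!mulmxA mulKmx// subrr.
Qed.

End Geodesics.

Theorem proposition2p3 (R : realType) (n p : nat) (hn : (2 <= n)%N)
    (hp : (p <= n)%N) :
  [/\ totally_geodesic (GLSym R n p) (Sym R n) (GL R n) fullv
        (@trace_metric R n),
      (forall (J : set R) (c : R -> 'M[R]_n), open_interval J ->
         (geodesic (GLSym R n p) (Sym R n) (@trace_metric R n) J c <->
          exists K V : 'M[R]_n,
            [/\ GLSym R n p K, V \in Sym R n &
                forall t : R, J t ->
                  c t = K *m expmx (t *: (invmx K *m V))])),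
      geodesically_complete (GLSym R n p) (Sym R n) (@trace_metric R n) &
      forall K X Y Z W : 'M[R]_n, GLSym R n p K ->
        X \in Sym R n -> Y \in Sym R n -> Z \in Sym R n -> W \in Sym R n ->
        forall fX fY fZ fW : 'M[R]_n -> 'M[R]_n,
          vector_field (GLSym R n p) (Sym R n) fX ->
          vector_field (GLSym R n p) (Sym R n) fY ->
          vector_field (GLSym R n p) (Sym R n) fZ ->
          vector_field (GLSym R n p) (Sym R n) fW ->
          fX K = X -> fY K = Y -> fZ K = Z -> fW K = W ->
          riemann4 (GLSym R n p) (Sym R n) (@trace_metric R n) fX fY fZ fW K =
            4%:R^-1 * \tr (commutator (invmx K *m X) (invmx K *m Y) *m
                           commutator (invmx K *m Z) (invmx K *m W))].
Proof.
have US := GLSym_submanifold R hp.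
have UGL := @GLSym_sub_GL R n p.
have Sg := GLSym_semi_riemannian R hp.
split.
- split.
  + by split; [exact: GL_submanifold|].
  + by split=> //; exact: subvf.
  + by split; [exact: GL_semi_riemannian|].
  + move=> X Y XF YF XS YS x Ux.
    rewrite (levi_civitaE _ _ _ _ XF YF (UGL x Ux)).
    * have SX := XS x Ux.
      apply: rpredB.
        2: by apply: rpredZ; exact: Sym_jordan Ux (XS x Ux) (YS x Ux).
      apply: (derive_mem US Ux SX YS).
      have [] // := vector_field_derivable (x := x) YF (UGL x Ux) (memvf (X x)).
    * exact: GL_submanifold.
    * by [].
    * exact: GL_semi_riemannian.
    * by move=> A u v _ _ _; rewrite memvf.
- move=> J c iJ; split; first exact: geodesic_exponential.
  by move=> [K [V [UK SV cE]]]; case: iJ => _ oJ _; exact: exponential_geodesic cE.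
- move=> J c iJ /(geodesic_exponential hp iJ)[K [V [UK SV cE]]].
  exists (fun t => K *m expmx (t *: (invmx K *m V))); split=> [|t Jt].
    by apply: (exponential_geodesic hp openT UK SV).
  by rewrite cE.
- move=> K X Y Z W UK _ _ _ _ fX fY fZ fW XF YF ZF _ <- <- <- <-.
  by apply: (riemann4E US UGL Sg _ _ XF YF ZF UK) => A u v; exact: Sym_jordan.
Qed.
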